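(* Let $\mu/\nu$ be a disconnected skew shape with two components $\mu^0/\nu^0$ and $\mu^1/\nu^1$. Let $N_i=|\mu^i/\nu^i|$ for $i=0,1$, and let $\theta\vdash N=N_0+N_1$. Then $$\Gamma^\theta_{\mu/\nu}=\sum_{\substack{\lambda\vdash N_0\\ \lambda<\theta}}\ \sum_{\sigma\vdash N_1}c^\theta_{\lambda\sigma}\,\Gamma^\lambda_{\mu^0/\nu^0}\circ\Gamma^\sigma_{\mu^1/\nu^1},$$ where $c^\theta_{\lambda\sigma}$ is the Littlewood-Richardson coefficient.
   Context: Partitions are weakly decreasing sequences of positive integers, extended by zeros when needed ($\nu$ may be empty). For partitions, $\lambda<\theta$ means $\lambda_i\le\theta_i$ for all $i$. A skew shape $\mu/\nu$ is a pair of partitions with $\nu_i\le\mu_i$ for all $i$; its diagram is the Young diagram of $\mu$ with the boxes of $\nu$ removed; its length $\ell(\mu/\nu)$ is the largest $i$ with $\nu_i<\mu_i$, and $|\mu/\nu|=\sum_i(\mu_i-\nu_i)$. Components are connected components of the diagram (boxes adjacent when sharing an edge), each regarded as a skew shape in its own right (up to translation of its diagram). For $\theta\vdash N$ and an integer sequence $c=(c_1,\ldots,c_n)$ summing to $N$, the Kostka number $K_{\theta,c}$ is the number of semistandard Young tableaux of shape $\theta$ with content $c$; it is $0$ if some $c_i<0$. For a skew shape $\mu/\nu$ and $n\ge\ell(\mu/\nu)$, let $\delta=(n-1,\ldots,1,0)$, regard $\mu,\nu$ as their first $n$ entries, and let $w\in S_n$ act by $w(a_1,\ldots,a_n)=(a_{w^{-1}(1)},\ldots,a_{w^{-1}(n)})$.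 For $\theta\vdash N=|\mu/\nu|$ the immanant character $\Gamma^\theta_{\mu/\nu}:S_n\to\mathbb{Z}$ is $$\Gamma^\theta_{\mu/\nu}(w)=\frac{n!}{|C(w)|}\sum_{w'\in C(w)}K_{\theta,\ \mu+\delta-w'(\nu+\delta)},$$ where $C(w)$ is the conjugacy class of $w$ in $S_n$. Standing assumption: the skew shapes $\mu/\nu$, $\mu^0/\nu^0$, $\mu^1/\nu^1$ have no empty rows (i.e. $\nu_i<\mu_i$ for all $i$ up to the length), and each immanant character is taken as a character of the symmetric group on as many letters as the shape has nonempty rows; thus $\Gamma^\theta_{\mu/\nu}$ lives on $S_n$, $n=\ell(\mu/\nu)=n_0+n_1$, and the others on $S_{n_0},S_{n_1}$ with $n_i=\ell(\mu^i/\nu^i)$. For virtual characters (integer-valued class functions) $\phi$ of $S_k$ and $\psi$ of $S_l$, the induction product is $\phi\circ\psi=(\phi\times\psi)\uparrow_{S_k\times S_l}^{S_{k+l}}$. *)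

(* Defs.v *)
From HB Require Import structures.
From mathcomp Require Import all_boot all_order all_algebra.
From mathcomp Require Import all_fingroup all_solvable all_field all_character.

Set Implicit Arguments.
Unset Strict Implicit.
Unset Printing Implicit Defensive.

Import Order.TTheory GRing.Theory Num.Theory.

(* A partition is the sequence of its (positive) parts; its entry of index i,  *)
(* counted from 0 and extended by zeros, is nth 0 p i. All indices of rows,    *)
(* columns, letters and tableau entries are counted from 0.                    *)
Definition is_part (p : seq nat) : bool := sorted geq p && (0 \notin p).

Definition included (p q : seq nat) : bool :=
  [forall i : 'I_(size p), nth 0 p i <= nth 0 q i].

(* A partition of N has at most N parts, each at most N. *)
Definition partitions (N : nat) : seq (seq nat) :=
  [seq p <- [seq [seq val i | i <- bseqval s] | s : N.-bseq 'I_N.+1]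
     | is_part p && (sumn p == N)].

Lemma mem_partitions N p : (p \in partitions N) = is_part p && (sumn p == N).
Proof.
rewrite mem_filter; case: (boolP (is_part p && _)) => //=.
case/andP=> [/andP[_ p_pos] /eqP p_sum]; apply/imageP.
have le_sum q x : x \in q -> x <= sumn q.
  elim: q => //= y q IHq; rewrite inE => /predU1P[->|/IHq le_x].
    exact: leq_addr.
  exact: leq_trans le_x (leq_addl _ _).
have le_size q : 0 \notin q -> size q <= sumn q.
  elim: q => //= y q IHq; rewrite inE negb_or eq_sym -lt0n => /andP[y_gt0 /IHq].
  by move=> le_q; rewrite -add1n leq_add.
have size_p : size [seq inord i : 'I_N.+1 | i <- p] <= N.
  by rewrite size_map -p_sum le_size.
exists (Bseq size_p) => //=; rewrite -map_comp -[LHS]map_id.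
apply/eq_in_map=> i p_i /=; rewrite inordK // ltnS -p_sum; exact: le_sum.
Qed.

Lemma partitions_uniq N : uniq (partitions N).
Proof.
rewrite filter_uniq // map_inj_uniq ?enum_uniq // => s t.
by move/(inj_map val_inj)/val_inj.
Qed.

Definition skew_shape (mu nu : seq nat) : bool :=
  [&& is_part mu, is_part nu & included nu mu].

Definition skew_len (mu nu : seq nat) : nat :=
  \max_(i < size mu | nth 0 nu i < nth 0 mu i) i.+1.

Definition skew_size (mu nu : seq nat) : nat :=
  \sum_(i < size mu) (nth 0 mu i - nth 0 nu i).

Definition no_empty_rows (mu nu : seq nat) : bool :=
  [forall i : 'I_(skew_len mu nu), nth 0 nu i < nth 0 mu i].

(* The diagram of mu / nu, as the finite type of its boxes (row, column). *)
Record box (mu nu : seq nat) : predArgType := Box {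
  coords : 'I_(size mu) * 'I_(head 0 mu);
  _ : nth 0 nu coords.1 <= coords.2 < nth 0 mu coords.1
}.
HB.instance Definition _ mu nu := [isSub for @coords mu nu].
HB.instance Definition _ mu nu := [Finite of box mu nu by <:].

Definition row_of mu nu (b : box mu nu) : nat := (coords b).1.
Definition col_of mu nu (b : box mu nu) : nat := (coords b).2.

Definition adjacent mu nu : rel (box mu nu) := fun b c =>
  (row_of b == row_of c)
    && ((col_of b == (col_of c).+1) || (col_of c == (col_of b).+1))
  || (col_of b == col_of c)
    && ((row_of b == (row_of c).+1) || (row_of c == (row_of b).+1)).

Definition component mu nu (b : box mu nu) : {set box mu nu} :=
  [set c | connect (@adjacent mu nu) b c].

(* A is the diagram of al / be moved by the integer vector (dr, dc). *)
Definition is_translate mu nu (A : {set box mu nu}) (al be : seq nat) : Prop :=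
  exists2 f : box al be -> box mu nu, [set f b | b in [set: box al be]] = A
    & exists dr dc : int, forall b : box al be,
        ((row_of (f b))%:Z = (row_of b)%:Z + dr
         /\ (col_of (f b))%:Z = (col_of b)%:Z + dc)%R.

Definition two_components (mu nu mu0 nu0 mu1 nu1 : seq nat) : Prop :=
  exists b0 b1 : box mu nu,
    [/\ component b0 != component b1,
        forall b : box mu nu,
          component b = component b0 \/ component b = component b1,
        is_translate (component b0) mu0 nu0
      & is_translate (component b1) mu1 nu1].

Lemma box_inj mu nu (b c : box mu nu) :
  row_of b = row_of c -> col_of b = col_of c -> b = c.
Proof.
case: b c => [[r k] bP] [[r' k'] cP]; rewrite /row_of /col_of /= => eq_r eq_k.
by apply: val_inj; congr (_, _); apply: val_inj.
Qed.

Lemma adjacentC mu nu (b c : box mu nu) : adjacent b c = adjacent c b.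
Proof.
rewrite /adjacent [row_of b == row_of c]eq_sym [col_of b == col_of c]eq_sym.
by congr (_ && _ || _ && _); rewrite orbC.
Qed.

Lemma row_bounds mu nu (b : box mu nu) :
  nth 0 nu (row_of b) <= col_of b < nth 0 mu (row_of b).
Proof. by case: b. Qed.

Lemma same_component mu nu (b c : box mu nu) :
  connect (@adjacent mu nu) b c -> component b = component c.
Proof.
have adjC: connect_sym (@adjacent mu nu) by apply: sym_connect_sym => x y; exact: adjacentC.
by move=> bc; apply/setP=> d; rewrite !inE; exact: same_connect.
Qed.

Lemma same_row_component mu nu (b c : box mu nu) :
  row_of b = row_of c -> component b = component c.
Proof.
wlog le_bc : b c / col_of b <= col_of c => [IH eq_row|].
  by case/orP: (leq_total (col_of b) (col_of c)) => [/IH|/IH/(_ (esym eq_row))/esym]; first exact.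
move: {2}(col_of c - col_of b) (erefl (col_of c - col_of b)) => m.
elim: m c le_bc => [|m IH] c le_bc def_m eq_row.
  congr component; apply: box_inj => //.
  by apply/eqP; rewrite eqn_leq le_bc -subn_eq0 def_m.
have [c' row_c' col_c'] : exists2 c' : box mu nu,
    row_of c' = row_of c & (col_of c').+1 = col_of c.
  have lt_bc : col_of b < col_of c by rewrite -subn_gt0 def_m.
  have c_gt0 := leq_ltn_trans (leq0n _) lt_bc.
  have lt_c : (col_of c).-1 < head 0 mu.
    by rewrite (leq_ltn_trans (leq_pred _)) // /col_of ltn_ord.
  have c'P : nth 0 nu (coords c).1 <= Ordinal lt_c < nth 0 mu (coords c).1.
    apply/andP; split => /=; last first.
      by rewrite (leq_ltn_trans (leq_pred _)) //; case/andP: (row_bounds c).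
    have -> : nat_of_ord (coords c).1 = row_of b by rewrite eq_row.
    have le_b : nth 0 nu (row_of b) <= col_of b by case/andP: (row_bounds b).
    by rewrite (leq_trans le_b) // -ltnS prednK.
  by exists (@Box mu nu ((coords c).1, Ordinal lt_c) c'P); rewrite /col_of //= prednK.
have -> : component b = component c'.
  apply: IH; rewrite ?eq_row //.
    by rewrite -ltnS col_c' -subn_gt0 def_m.
  by apply: succn_inj; rewrite -def_m -col_c' subSn // -ltnS col_c' -subn_gt0 def_m.
apply: same_component; apply: connect1.
by rewrite /adjacent row_c' eqxx -col_c' eqxx orbT.
Qed.

Lemma size_rows mu nu : no_empty_rows mu nu -> is_part mu ->
  size (undup [seq row_of b | b : box mu nu]) = skew_len mu nu.
Proof.
move=> /forallP full /andP[mu_sorted _]; rewrite -[RHS](size_iota 0); apply/perm_size/uniq_perm.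
- exact: undup_uniq.
- exact: iota_uniq.
move=> i; rewrite mem_undup mem_iota add0n /=; apply/imageP/idP => [[b _ ->]|lt_i].
  case: b => [[r k] /= bP]; rewrite /row_of /=; case/andP: bP => le_k lt_k.
  by apply: (bigop.leq_bigmax_cond r); exact: leq_ltn_trans lt_k.
have lt_row := full (Ordinal lt_i); rewrite /= in lt_row.
have lt_size : i < size mu.
  by rewrite ltnNge; apply/negP=> /(nth_default 0) mu_i; rewrite mu_i in lt_row.
have lt_head : nth 0 nu i < head 0 mu.
  apply: leq_trans lt_row _; rewrite -nth0.
  apply: (@sorted_leq_nth _ geq _ _ 0) => //.
  - by move=> x y z /= le_xy le_zx; exact: leq_trans le_zx le_xy.
  - exact: leqnn.
  by rewrite inE (leq_ltn_trans _ lt_size).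
have bP : nth 0 nu (Ordinal lt_size) <= Ordinal lt_head < nth 0 mu (Ordinal lt_size).
  by rewrite leqnn.
by exists (@Box mu nu (Ordinal lt_size, Ordinal lt_head) bP).
Qed.

Lemma size_rows_translate mu nu (A : {set box mu nu}) al be :
    is_translate A al be ->
  size (undup [seq row_of b | b in A]) =
  size (undup [seq row_of b | b : box al be]) /\ #|A| = #|{: box al be}|.
Proof.
case=> f def_A [dr [dc f_move]].
have f_inj : injective f.
  move=> b c eq_f; have [row_b col_b] := f_move b; have [row_c col_c] := f_move c.
  rewrite eq_f in row_b col_b.
  apply: box_inj; apply/eqP; rewrite -eqz_nat; apply/eqP.
    by apply: (@addIr _ dr); rewrite -row_b.
  by apply: (@addIr _ dc); rewrite -col_b.
split; last by rewrite -def_A card_imset // cardsT.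
have PoszI : injective Posz by move=> i j [].
rewrite -(size_map Posz) -(undup_map_inj PoszI) -map_comp.
have addI : injective (fun i : nat => i%:Z + dr)%R.
  by move=> i j /addIr[].
rewrite -[in RHS](size_map (fun i : nat => i%:Z + dr)%R) -undup_map_inj // -map_comp.
apply/perm_size/uniq_perm; rewrite ?undup_uniq // => z; rewrite !mem_undup.
apply/imageP/imageP=> [[b A_b ->]|[b _ ->]] /=.
  move: A_b; rewrite -def_A => /imsetP[c _ ->]; exists c => //.
  by have [] := f_move c.
exists (f b); first by rewrite -def_A imset_f.
by have [] := f_move b.
Qed.

Lemma card_box mu nu : is_part mu -> #|{: box mu nu}| = skew_size mu nu.
Proof.
case/andP=> mu_sorted _.
pose P (p : 'I_(size mu) * 'I_(head 0 mu)) := nth 0 nu p.1 <= p.2 < nth 0 mu p.1.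
have -> : #|{: box mu nu}| = #|P|.
  rewrite -(card_image (@val_inj _ _ (box mu nu))); apply: eq_card => p.
  apply/imageP/idP => [[b _ ->]|Pp]; first by case: b.
  by exists (Box Pp).
rewrite -sum1_card (eq_bigl (fun p => xpredT p.1 && P (p.1, p.2))); last by case.
rewrite -(pair_big_dep xpredT (fun i j => P (i, j)) (fun _ _ => 1)) /=.
apply: eq_bigr => i _ /=.
have le_head : nth 0 mu i <= head 0 mu.
  rewrite -nth0; apply: (@sorted_leq_nth _ geq _ _ 0) => //.
  - by move=> x y z /= le_xy le_zx; exact: leq_trans le_zx le_xy.
  - exact: leqnn.
  - by rewrite inE (leq_ltn_trans _ (ltn_ord i)).
  - by rewrite inE ltn_ord.
rewrite -[X in _ = X]muln1 -sum_nat_const_nat.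
rewrite big_geq_mkord /=.
rewrite (big_ord_widen_cond _ (fun j => nth 0 nu i <= j) (fun _ => 1) le_head).
by apply: eq_bigl => j.
Qed.

(* Hence S_(l(mu/nu)) and |mu/nu| may be taken as S_(n0 + n1) and N0 + N1,    *)
(* which avoids casting class functions along an equality of degrees.          *)
Lemma two_components_len_size mu nu mu0 nu0 mu1 nu1 :
    skew_shape mu nu -> skew_shape mu0 nu0 -> skew_shape mu1 nu1 ->
    no_empty_rows mu nu -> no_empty_rows mu0 nu0 -> no_empty_rows mu1 nu1 ->
    two_components mu nu mu0 nu0 mu1 nu1 ->
  skew_len mu nu = skew_len mu0 nu0 + skew_len mu1 nu1
  /\ skew_size mu nu = skew_size mu0 nu0 + skew_size mu1 nu1.
Proof.
case/and3P=> p _ _ /and3P[p0 _ _] /and3P[p1 _ _] full full0 full1.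
case=> b0 [b1 [neq01 all01]].
move=> /size_rows_translate[rows0 card0] /size_rows_translate[rows1 card1].
have mem_comp (b : box mu nu) : b \in component b by rewrite inE.
split; last first.
  rewrite -!card_box // -card0 -card1 -cardsUI.
  have -> : component b0 :&: component b1 = set0.
    apply/setP=> b; rewrite !inE; apply/andP=> [[]].
    move=> /same_component comp_b0 /same_component comp_b1.
    by case/eqP: neq01; rewrite comp_b0 comp_b1.
  rewrite cards0 addn0 -cardsT; congr #|pred_of_set _|; apply/setP=> b.
  rewrite in_setT in_setU; have b_b := mem_comp b.
  by case: (all01 b) => eq_b; rewrite eq_b in b_b; rewrite b_b ?orbT.
rewrite -!size_rows // -rows0 -rows1 -size_cat; apply/perm_size/uniq_perm.
- exact: undup_uniq.
- rewrite cat_uniq !undup_uniq /= andbT; apply/hasPn=> i; rewrite !mem_undup.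
  case/imageP=> b; rewrite inE => /same_component comp_b ->.
  apply/imageP=> [[c]]; rewrite inE => /same_component comp_c eq_row.
  by case/eqP: neq01; rewrite comp_b comp_c (same_row_component eq_row).
move=> i; rewrite mem_cat !mem_undup; apply/imageP/orP => [[b _ ->]|[]/imageP[b _ ->]].
- have b_b := mem_comp b.
  by case: (all01 b) => eq_b; rewrite eq_b in b_b; [left|right]; apply: image_f.
- by exists b.
- by exists b.
Qed.
Definition semistandard mu nu n (T : {ffun box mu nu -> 'I_n}) : bool :=
  [forall b : box mu nu, forall c : box mu nu,
     ((row_of b == row_of c) && (col_of b <= col_of c) ==> (T b <= T c))
     && ((col_of b == col_of c) && (row_of b < row_of c) ==> (T b < T c))].

Definition kostka (n : nat) (theta : seq nat) (c : 'I_n -> int) : nat :=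
  #|[set T : {ffun box theta [::] -> 'I_n} |
      semistandard T && [forall k, Posz #|[set b | T b == k]| == c k]]|.

(* The number of occurrences of k in the part, ending at b, of the word read   *)
(* from T along the rows from top to bottom, each row from right to left.      *)
Definition read_count mu nu n (T : {ffun box mu nu -> 'I_n}) (b : box mu nu)
    (k : 'I_n) : nat :=
  #|[set c : box mu nu | (T c == k) &&
      ((row_of c < row_of b)
       || (row_of c == row_of b) && (col_of b <= col_of c))]|.

Definition lattice_word mu nu n (T : {ffun box mu nu -> 'I_n}) : bool :=
  [forall b : box mu nu, forall k : 'I_n, forall l : 'I_n,
     (val l == (val k).+1) ==> (read_count T b l <= read_count T b k)].

(* The Littlewood-Richardson coefficient c^theta_(la si), as the number of     *)
(* Littlewood-Richardson tableaux of shape theta / la and content si.          *)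
Definition LR_coef (theta la si : seq nat) : nat :=
  if included la theta then
    #|[set T : {ffun box theta la -> 'I_(size si)} |
        [&& semistandard T, lattice_word T
          & [forall k : 'I_(size si), #|[set b | T b == k]| == nth 0 si k]]]|
  else 0.

Local Open Scope ring_scope.

(* mu + delta - w (nu + delta), where delta = (n - 1, ..., 1, 0). *)
Definition immanant_content (n : nat) (mu nu : seq nat) (w : 'S_n) :
    'I_n -> int := fun i =>
  let shifted (p : seq nat) (j : 'I_n) : int :=
    Posz (nth 0%N p j + (n.-1 - j))%N in
  shifted mu i - shifted nu ((w^-1)%g i).

Definition immanant_val (n : nat) (theta mu nu : seq nat) (w : 'S_n) : algC :=
  (n`!)%:R / #|(w ^: [set: 'S_n])%g|%:R *
  \sum_(w' in (w ^: [set: 'S_n])%g) (kostka theta (immanant_content mu nu w'))%:R.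

Fact immanant_subproof n theta mu nu :
  is_class_fun <<[set: 'S_n]>>%g [ffun w => immanant_val theta mu nu w].
Proof.
rewrite genGid; apply: intro_class_fun => [x y _ _|x]; last by rewrite inE.
by rewrite /immanant_val classGidl ?inE.
Qed.
Definition immanant (n : nat) (theta mu nu : seq nat) : 'CF([set: 'S_n]) :=
  Cfun 0 (immanant_subproof n theta mu nu).

Section InductionProduct.

Variables k l : nat.

Definition block_fun (st : 'S_k * 'S_l) (i : 'I_(k + l)) : 'I_(k + l) :=
  match split i with
  | inl a => lshift l (st.1 a)
  | inr b => rshift k (st.2 b)
  end.

Fact block_fun_inj st : injective (block_fun st).
Proof.
move=> i j; rewrite -(splitK i) -(splitK j).
case: (split i) => a; case: (split j) => b; rewrite /block_fun !unsplitK /=.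
- by move/lshift_inj/perm_inj->.
- by move/eqP; rewrite eq_lrshift.
- by move/eqP; rewrite eq_rlshift.
- by move/rshift_inj/perm_inj->.
Qed.

(* The embedding of S_k x S_l into S_(k + l). *)
Definition block_perm (st : 'S_k * 'S_l) : 'S_(k + l) :=
  perm (@block_fun_inj st).

Fact block_permM : {in [set: 'S_k * 'S_l] &,
  {morph block_perm : x y / (x * y)%g >-> (x * y)%g}}.
Proof.
move=> x y _ _; apply/permP=> i; rewrite -(splitK i) permM !permE /block_fun.
case: (split i) => a; rewrite unsplitK.
  by rewrite (unsplitK (inl _)) permM.
by rewrite (unsplitK (inr _)) permM.
Qed.
Canonical block_perm_morphism := Morphism block_permM.

Fact block_perm_injm : ('injm block_perm_morphism)%g.
Proof.
apply/injmP=> [[s t] [s' t'] _ _] /= /permP eq_st.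
congr pair; apply/permP=> a.
  have:= eq_st (lshift l a); rewrite !permE /block_fun.
  by rewrite (unsplitK (inl _)) => /lshift_inj.
have:= eq_st (rshift k a); rewrite !permE /block_fun.
by rewrite (unsplitK (inr _)) => /rshift_inj.
Qed.

Definition young_subgroup : {group 'S_(k + l)} :=
  (block_perm_morphism @* [set: 'S_k * 'S_l])%G.

Fact block_perm_isom :
  isom [set: 'S_k * 'S_l] young_subgroup block_perm_morphism.
Proof. exact: sub_isom block_perm_injm. Qed.

Fact ext_prod_subproof (phi : 'CF([set: 'S_k])) (psi : 'CF([set: 'S_l])) :
  is_class_fun <<[set: 'S_k * 'S_l]>>%g [ffun st => phi st.1 * psi st.2].
Proof.
rewrite genGid; apply: intro_class_fun => [x y _ _|x]; last by rewrite inE.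
by rewrite /= !cfunJ ?inE.
Qed.
Definition ext_prod phi psi : 'CF([set: 'S_k * 'S_l]) :=
  Cfun 0 (ext_prod_subproof phi psi).

Definition ind_prod (phi : 'CF([set: 'S_k])) (psi : 'CF([set: 'S_l])) :
    'CF([set: 'S_(k + l)]) :=
  'Ind[[set: 'S_(k + l)], young_subgroup]
    (cfIsom block_perm_isom (ext_prod phi psi)).

End InductionProduct.

(* Main.v *)
Require Import Defs.
From HB Require Import structures.
From mathcomp Require Import all_boot all_order all_algebra.
From mathcomp Require Import all_fingroup all_solvable all_field all_character.
From mathcomp Require Import zify ring.

Set Implicit Arguments.
Unset Strict Implicit.
Unset Printing Implicit Defensive.

Import Order.TTheory GRing.Theory Num.Theory.

(** Summing over the group instead of over a conjugacy class, the immanant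
    character at [w] is the sum over all [g] of the Kostka number whose content
    is [mu + delta - (w ^ g)(nu + delta)] ([immanantE]). As the two components
    share no edge, every row of the lower one ends, in [mu], no further right
    than any row of the upper one starts, in [nu]. A permutation moving a row of
    one component to a row of the other therefore creates a negative entry in
    the content and contributes [0]; the remaining ones form a Young subgroup,
    on which the content is the concatenation of the contents of the two
    components. Since an induction product of two such group sums is again a
    group sum supported on the Young subgroup ([ind_prodE]), the statement is
    reduced to the identity [kostka_concat], the coproduct formula
    [K_(th, c0 c1) = sum c^th_(la si) K_(la, c0) K_(si, c1)].
    If the first component is the lower one, the contents come out in the order
    [c1 c0], and Kostka numbers have to be symmetric in the content
    ([skew_kostka_perm]).

    The coproduct formula comes from cutting a tableau of shape [th] after its
    first letters ([kostka_split]) and from the Littlewood-Richardson rule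
    [K_(th/la, c) = sum c^th_(la si) K_(si, c)] for arbitrary contents [c]
    ([Littlewood_Richardson]). Both the symmetry and this rule are read off from
    Gelfand-Tsetlin patterns. The level [k] of the pattern of a tableau is the
    shape filled by its letters below [k]; between two fixed neighbours each
    entry of a level ranges over an interval, independently of the others, and
    the Bender-Knuth involution is the reversal of all these intervals.

    The rule itself follows the lines of Stembridge's proof. Multiply the
    generating function of the tableaux by the alternant of [delta]: every
    tableau contributes an alternant of its weight plus [delta]. A tableau whose
    reading word is not a lattice word is paired with another one by reversing
    the intervals of a single level from its first failure on; the shifted
    weights differ by a transposition, so the two alternants cancel
    ([alt_sum_lattice]). What is left is one alternant for each
    Littlewood-Richardson tableau, and for straight shapes a single alternant
    ([alt_sum_straight]). Dividing by the alternant of [delta] is possible since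
    [delta] is strictly highest among its rearrangements
    ([alternant_inversion]). *)

(** * Partitions, boxes, and tableaux as Gelfand-Tsetlin patterns *)

Lemma part_nth_leq p i j : is_part p -> i <= j -> nth 0 p j <= nth 0 p i.
Proof.
case/andP=> p_sorted _ le_ij; case: (ltnP j (size p)) => [lt_j|le_j].
  apply: (@sorted_leq_nth _ geq _ _ 0) => //.
  - by move=> x y z /= le_xy le_zx; exact: leq_trans le_zx le_xy.
  - exact: leqnn.
  by rewrite inE (leq_ltn_trans le_ij).
by rewrite nth_default.
Qed.

Lemma part_nth_gt0 p i : is_part p -> (0 < nth 0 p i) = (i < size p).
Proof.
case/andP=> _ p_pos; case: (ltnP i (size p)) => lt_i; last by rewrite nth_default.
by rewrite lt0n; apply: contraNneq p_pos => <-; apply: mem_nth.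
Qed.

Lemma part_ext p q : is_part p -> is_part q ->
  (forall i, nth 0 p i = nth 0 q i) -> p = q.
Proof.
move=> p_part q_part eq_pq; apply: (@eq_from_nth _ 0) => // .
have leP a b : is_part a -> is_part b -> (forall i, nth 0 a i = nth 0 b i) ->
    size a <= size b.
  move=> ha hb eq_ab; case: leqP => // lt_ba.
  by move: (part_nth_gt0 (size b) ha); rewrite lt_ba eq_ab nth_default.
by apply/eqP; rewrite eqn_leq !leP.
Qed.

Lemma includedP p q :
  reflect (forall i, nth 0 p i <= nth 0 q i) (included p q).
Proof.
apply: (iffP forallP) => [le_pq i|le_pq i]; last exact: le_pq.
case: (ltnP i (size p)) => [lt_i|le_i]; first exact: (le_pq (Ordinal lt_i)).
by rewrite nth_default.
Qed.

Lemma included_size p q : is_part p -> included p q -> size p <= size q.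
Proof.
move=> p_part /includedP le_pq; case: leqP => // lt_qp.
by move: (le_pq (size q)); rewrite leqNgt [nth 0 q _]nth_default // part_nth_gt0 // lt_qp.
Qed.

Lemma sumn_nth p R : size p <= R -> sumn p = \sum_(r < R) nth 0 p r.
Proof.
move=> le_p; rewrite sumnE (big_nth 0) big_mkord.
rewrite (big_ord_widen R (fun i => nth 0 p i) le_p) big_mkcond /=.
by apply: eq_bigr => i _; case: ltnP => // h; rewrite nth_default.
Qed.

Lemma part_of_fun (h : nat -> nat) R : (forall r, h r.+1 <= h r) -> h R = 0 ->
  exists2 p, is_part p & forall r, nth 0 p r = h r.
Proof.
move=> h_dec hR.
have h_le i j : i <= j -> h j <= h i.
  by move=> /subnK <-; elim: (j - i) => // m IH; rewrite addSn (leq_trans (h_dec _)).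
have [m hm m_min] : exists2 m, h m = 0 & forall r, r < m -> 0 < h r.
  have ex_m : exists m, h m == 0 by exists R; rewrite hR.
  exists (ex_minn ex_m); first by case: ex_minnP => m /eqP.
  by case: ex_minnP => m _ m_min r; rewrite lt0n; apply: contraTneq => /eqP/m_min; rewrite -leqNgt.
exists (mkseq h m) => [|r]; last first.
  case: (ltnP r m) => lt_r; first by rewrite nth_mkseq.
  rewrite nth_default ?size_mkseq //; apply/esym/eqP.
  by rewrite -leqn0 -hm h_le.
rewrite /is_part; apply/andP; split.
  rewrite /mkseq sorted_map; apply: (@sub_sorted _ ltn) (iota_ltn_sorted 0 m) => i j /= lt_ij.
  by rewrite h_le // ltnW.
apply/mapP=> -[r]; rewrite mem_iota add0n => /m_min h_gt0 h0.
by rewrite -h0 in h_gt0.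
Qed.

(** Boxes live in a bounding rectangle cut out by a boolean condition; this
    turns sums over them into double sums over genuine row intervals. *)
Lemma sum_box th la (F : nat -> nat -> nat) : is_part th ->
  \sum_(b : box th la) F (row_of b) (col_of b) =
  \sum_(r < size th) \sum_(nth 0 la r <= j < nth 0 th r) F r j.
Proof.
move=> th_part.
pose P (p : 'I_(size th) * 'I_(head 0 th)) := nth 0 la p.1 <= p.2 < nth 0 th p.1.
transitivity (\sum_(p | P p) F p.1 p.2).
  rewrite (reindex_omap (@coords th la) insub) => [|p Pp]; last by rewrite (insubT P Pp).
  by apply: eq_big => [b|b _] //=; rewrite valK eqxx andbT; case: b.
rewrite (eq_bigl (fun p => xpredT p.1 && P (p.1, p.2))); last by case.
rewrite -(pair_big_dep xpredT (fun i j => P (i, j)) (fun i j => F i j)) /=.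
apply: eq_bigr => i _ /=; rewrite big_geq_mkord /=.
have le_head : nth 0 th i <= head 0 th by rewrite -nth0 part_nth_leq.
rewrite (big_ord_widen_cond _ (fun j => nth 0 la i <= j) (fun j => F i j) le_head).
by apply: eq_bigl => j.
Qed.

Lemma card_boxes th la (P : nat -> nat -> bool) : is_part th ->
  #|[set b : box th la | P (row_of b) (col_of b)]| =
  \sum_(r < size th) \sum_(nth 0 la r <= j < nth 0 th r) P r j.
Proof.
move=> th_part; rewrite -(sum_box la (fun r j => P r j : nat)) // -sum1_card big_mkcond.
by apply: eq_bigr => b _; rewrite inE; case: (P _ _).
Qed.

Lemma sum_interval a b m : \sum_(a <= j < b) (j < m) = minn m b - a.
Proof.
elim: b => [|b IH]; first by rewrite big_geq // minn0.
case: (leqP a b) => le_ab; first by rewrite big_nat_recr //= IH; lia.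
by rewrite big_geq //; lia.
Qed.

Lemma card_row th la r m : is_part th -> included la th ->
  nth 0 la r <= m <= nth 0 th r ->
  #|[set b : box th la | (row_of b == r) && (col_of b < m)]| = m - nth 0 la r.
Proof.
move=> th_part la_th /andP[le_m m_le].
rewrite (card_boxes _ (fun i j => (i == r) && (j < m))) //.
case: (ltnP r (size th)) => lt_r; last first.
  rewrite big1 => [|i _]; first by rewrite nth_default // in m_le; lia.
  by rewrite big1 // => j _; have := ltn_ord i; lia.
rewrite (bigD1 (Ordinal lt_r)) //= [X in _ + X]big1 => [|i /negbTE neq_i]; last first.
  by rewrite big1 // => j _; rewrite -val_eqE /= in neq_i; rewrite neq_i.
by rewrite addn0 eqxx /= sum_interval; lia.
Qed.

Section Patterns.

Variables (n : nat) (th la : seq nat).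
Implicit Type T : {ffun box th la -> 'I_n}.

(** Entry [r] of level [k]: the end of row [r] in the shape formed by [la] and
    the boxes with a letter below [k]. It is defined as a cardinal, so that it
    makes sense before the tableau is known to be semistandard. *)
Definition pat T (k r : nat) : nat :=
  nth 0 la r + #|[set b | (row_of b == r) && (T b < k)]|.

(** Levels are functions of the row, zero beyond the last row, instead of
    partitions: the interlacing inequalities alone make them decreasing. Level
    [0] is the inner and level [n] the outer shape. *)
Definition gt_pattern (g : nat -> nat -> nat) : Prop :=
  [/\ forall r, g 0 r = nth 0 la r, forall r, g n r = nth 0 th r,
      forall k r, k < n -> g k r <= g k.+1 r
    & forall k r, k < n -> g k.+1 r.+1 <= g k r].

Lemma semistandardP T :
  reflect ((forall b c, row_of b = row_of c -> col_of b <= col_of c -> T b <= T c)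
        /\ (forall b c, col_of b = col_of c -> row_of b < row_of c -> T b < T c))
    (semistandard T).
Proof.
apply: (iffP forallP) => [ss|[ssr ssc] b].
  split=> b c.
    by have /forallP/(_ c)/andP[/implyP H _] := ss b => /eqP eq_r le_c; apply: H; rewrite eq_r.
  by have /forallP/(_ c)/andP[_ /implyP H] := ss b => /eqP eq_r le_c; apply: H; rewrite eq_r.
apply/forallP=> c; apply/andP; split; apply/implyP=> /andP[/eqP h1 h2].
  exact: ssr.
exact: ssc.
Qed.

Hypotheses (th_part : is_part th) (la_part : is_part la) (la_th : included la th).

Lemma box_at r j : nth 0 la r <= j < nth 0 th r ->
  exists2 b : box th la, row_of b = r & col_of b = j.
Proof.
move=> rj; have /andP[_ lt_j] := rj.
have lt_r : r < size th by rewrite -part_nth_gt0 // (leq_ltn_trans (leq0n j)).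

have lt_h : j < head 0 th by rewrite -nth0; apply: leq_trans lt_j (part_nth_leq _ _).
by exists (@Box th la (Ordinal lt_r, Ordinal lt_h) rj).
Qed.

Lemma pat_ge T k r : nth 0 la r <= pat T k r.
Proof. exact: leq_addr. Qed.

Lemma pat_mono T k l r : k <= l -> pat T k r <= pat T l r.
Proof.
move=> le_kl; rewrite leq_add2l subset_leq_card //; apply/subsetP=> b.
by rewrite !inE => /andP[-> /=]/leq_trans->.
Qed.

Lemma pat_le T k r : pat T k r <= nth 0 th r.
Proof.
have la_r := includedP _ _ la_th r.
rewrite -(subnKC la_r) leq_add2l -(@card_row th la) ?leqnn ?andbT //.
apply: subset_leq_card; apply/subsetP=> b; rewrite !inE => /andP[/eqP <- _].
by rewrite eqxx; case/andP: (row_bounds b).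
Qed.

Lemma pat_start T r : pat T 0 r = nth 0 la r.
Proof.
by rewrite /pat (_ : [set _ | _] = set0) ?cards0 ?addn0 //; apply/setP=> b; rewrite !inE ltn0 andbF.
Qed.

Lemma pat_end T k r : n <= k -> pat T k r = nth 0 th r.
Proof.
move=> le_k.
have la_r := includedP _ _ la_th r.
rewrite -(subnKC la_r) -(@card_row th la) ?leqnn ?andbT // /pat.
congr (_ + #|pred_of_set _|); apply/setP=> b; rewrite !inE (leq_trans (ltn_ord _)) //.
by case: eqP => // <-; case/andP: (row_bounds b) => _ ->.
Qed.

(** Since rows increase weakly, the boxes of a row with a letter below [k]
    form an initial segment; its length therefore decides which letters are
    below [k]. *)
Lemma pat_lt T b k : semistandard T -> (T b < k) = (col_of b < pat T k (row_of b)).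
Proof.
case/semistandardP=> ssr _; have /andP[le_b lt_b] := row_bounds b.
case: (ltnP (T b) k) => le_k; apply/esym.
  apply: (@leq_trans (nth 0 la (row_of b) + ((col_of b).+1 - nth 0 la (row_of b)))); first lia.
  rewrite leq_add2l -(@card_row th la) //; last by lia.
  apply: subset_leq_card; apply/subsetP=> c; rewrite !inE => /andP[/eqP eq_r le_c].
  by rewrite eq_r eqxx /= (leq_ltn_trans _ le_k) // ssr.
apply: negbTE; rewrite -leqNgt.
apply: (@leq_trans (nth 0 la (row_of b) + (col_of b - nth 0 la (row_of b)))); last lia.
rewrite leq_add2l -(@card_row th la) //; last by lia.
apply: subset_leq_card; apply/subsetP=> c; rewrite !inE => /andP[/eqP eq_r lt_c].
rewrite eq_r eqxx /= ltnNge; apply/negP=> le_c.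
by have := ssr _ _ (esym eq_r) le_c; rewrite leqNgt (leq_trans lt_c).
Qed.

(** The inequality [pat T k.+1 r.+1 <= pat T k r] is column strictness:
    otherwise the box just past level [k] in row [r] would carry a letter at
    least [k], and the box below it a letter at most [k]. *)
Lemma pat_gt T : semistandard T -> gt_pattern (pat T).
Proof.
move=> ss; have /semistandardP[_ ssc] := ss.
split=> [r|r|k r _|k r _]; [exact: pat_start|by rewrite pat_end|exact: pat_mono|].
case: leqP => // lt_c.
have [] := @box_at r (pat T k r).
  by rewrite pat_ge (leq_trans lt_c) // (leq_trans (pat_le _ _ _)) // part_nth_leq.
move=> b row_b col_b.
have [] := @box_at r.+1 (pat T k r).
  rewrite (leq_trans _ (pat_ge _ _ _)) ?part_nth_leq //=.
  exact: leq_trans lt_c (pat_le _ _ _).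
move=> c row_c col_c.
have lt_bc : T b < T c by apply: ssc; rewrite ?col_b ?col_c // row_b row_c.
have : T c < k.+1 by rewrite pat_lt // row_c col_c.
rewrite ltnS leqNgt => /negP[]; apply: leq_ltn_trans lt_bc.
by rewrite leqNgt pat_lt // row_b col_b ltnn.
Qed.

Lemma pat_inj T T' : semistandard T -> semistandard T' ->
  (forall k r, k <= n -> pat T k r = pat T' k r) -> T = T'.
Proof.
move=> ss ss' eq_p; apply/ffunP=> b; apply: val_inj => /=.
have le k : k <= n -> (T b < k) = (T' b < k) by move=> le_k; rewrite !pat_lt // eq_p.
apply/eqP; rewrite eqn_leq -ltnS le ?ltn_ord // ltnSn /=.
by rewrite -ltnS -le ?ltn_ord // ltnSn.
Qed.

Lemma gt_mono g k l r : gt_pattern g -> k <= l -> l <= n -> g k r <= g l r.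
Proof.
case=> _ _ g_row _ /subnK <-; elim: (l - k) => // m IH le_n.
by rewrite addSn (leq_trans (IH _)) ?g_row // ltnW.
Qed.

Lemma gt_dec g k i j : gt_pattern g -> k <= n -> i <= j -> g k j <= g k i.
Proof.
move=> gP le_k /subnK <-; elim: (j - i) => // m IH.
rewrite addSn (leq_trans _ IH) //; case: gP le_k => g0 _ g_row g_col.
by case: k {IH} => [|k] lt_k; rewrite ?g0 ?part_nth_leq // (leq_trans (g_col _ _ lt_k)) ?g_row.
Qed.

Lemma gt_bounds g k r : gt_pattern g -> k <= n -> nth 0 la r <= g k r <= nth 0 th r.
Proof. by move=> gP le_k; case: (gP) => <- <- _ _; rewrite !gt_mono. Qed.

End Patterns.

Section Tableau.

Variables (n : nat) (th la : seq nat).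
Hypotheses (th_part : is_part th) (la_part : is_part la) (la_th : included la th).

(** The letter in a box is the first [k] such that the box lies inside level
    [k.+1]. *)
Definition tab (g : nat -> nat -> nat) : {ffun box th la -> 'I_n.+1} :=
  [ffun b => inord (find (fun k => col_of b < g k.+1 (row_of b)) (iota 0 n.+1))].

Variable g : nat -> nat -> nat.
Hypothesis gP : gt_pattern n.+1 th la g.

Lemma tab_lt b k : k <= n.+1 -> (tab g b < k) = (col_of b < g k (row_of b)).
Proof.
have /andP[le_b lt_b] := row_bounds b; case: (gP) => g0 gn _ _.
have has_iota m : m <= n.+1 ->
    has (fun k => col_of b < g k.+1 (row_of b)) (iota 0 m) = (col_of b < g m (row_of b)).
  move=> le_m; apply/hasP/idP => [[i]|lt_m].
    rewrite mem_iota => /andP[_ lt_i] lt_c; apply: leq_trans lt_c _.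
    by apply: gt_mono gP _ _ => //; lia.
  case: m le_m lt_m => [|m] le_m lt_m; first by rewrite g0 ltnNge le_b in lt_m.
  by exists m => //; rewrite mem_iota; lia.
move=> le_k; rewrite ffunE inordK; last first.
  by have := has_iota n.+1 (leqnn _); rewrite gn lt_b has_find size_iota.
by rewrite -has_iota // -has_take_leq ?size_iota // take_iota (minn_idPl le_k).
Qed.

Lemma tab_semistandard : semistandard (tab g).
Proof.
apply/semistandardP; split=> b c.
  move=> eq_r le_c; rewrite -ltnS tab_lt ?ltn_ord // eq_r.
  apply: leq_ltn_trans le_c _; rewrite -tab_lt //; exact: ltnSn.
move=> eq_c lt_r; have lt_n := ltn_ord (tab g c).
have : col_of c < g (tab g c).+1 (row_of c) by rewrite -tab_lt.
rewrite tab_lt ?(ltnW lt_n) // eq_c => /leq_trans-> //.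
case: (gP) => _ _ _ g_col; apply: leq_trans (g_col _ _ lt_n).
exact: (@gt_dec n.+1 th la).
Qed.

Lemma pat_tab k r : k <= n.+1 -> pat (tab g) k r = g k r.
Proof.
move=> le_k; have gb := gt_bounds r gP le_k.
rewrite /pat (_ : [set _ | _] = [set b : box th la | (row_of b == r) && (col_of b < g k r)]).
  by rewrite card_row //; lia.
by apply/setP=> b; rewrite !inE; case: eqP => // <-; rewrite tab_lt.
Qed.

End Tableau.

(** * Weights, and toggling one level of a pattern *)

Lemma card_addb (X : finType) (P Q R : pred X) :
    (forall x, P x = Q x + R x :> nat) ->
  #|[set x | P x]| = #|[set x | Q x]| + #|[set x | R x]|.
Proof.
move=> PQR; have E (A : pred X) : #|[set x | A x]| = \sum_x A x.
  by rewrite -sum1_card big_mkcond; apply: eq_bigr => x _; rewrite inE; case: (A x).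
by rewrite !E -big_split; apply: eq_bigr => x _; exact: PQR.
Qed.

Lemma sum_pat n th la (T : {ffun box th la -> 'I_n}) k i :
  \sum_(r < i) pat T k r =
  \sum_(r < i) nth 0 la r + #|[set b | (row_of b < i) && (T b < k)]|.
Proof.
elim: i => [|i IH].
  by rewrite !big_ord0 (_ : [set _ | _] = set0) ?cards0 //; apply/setP=> b; rewrite !inE.
rewrite !big_ord_recr /= IH.
rewrite [in RHS](@card_addb _ _ (fun b => (row_of b < i) && (T b < k))
          (fun b => (row_of b == i) && (T b < k))); first by rewrite /pat /=; lia.
by move=> b /=; rewrite ltnS; case: (ltngtP (row_of b) i); case: (T b < k).
Qed.

Definition weight n th la (T : {ffun box th la -> 'I_n}) (k : 'I_n) : nat :=
  #|[set b | T b == k]|.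

Lemma row_lt th la (b : box th la) : row_of b < size th.
Proof. exact: ltn_ord. Qed.

(** Weights are differences of the sizes of consecutive levels. The bound [R]
    is arbitrary so that rows beyond the shape can be included. *)
Lemma sum_pat_weight n th la (T : {ffun box th la -> 'I_n}) (k : 'I_n) R :
    size th <= R ->
  \sum_(r < R) pat T k.+1 r = \sum_(r < R) pat T k r + weight T k.
Proof.
move=> le_R; rewrite !sum_pat -addnA; congr (_ + _).
apply: card_addb => b /=; rewrite (leq_trans (row_lt b) le_R) /=.
by rewrite ltnS -val_eqE; case: ltngtP.
Qed.

Section Toggle.

Variables (al ka be : nat -> nat).

(** Given consecutive levels [al], [ka], [be] of a pattern, the entry [ka r]
    is confined to the interval from [maxn (al r) (be r.+1)] to [minn (be r)
    (al r.-1)]. Toggling reverses these intervals in the rows after [i]; in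
    row [i] the upper end is [u], and the rows before [i] are kept. With [i =
    0] and [u = be 0] this is the Bender-Knuth involution. *)
Definition toggle (i u r : nat) : nat :=
  if r < i then ka r
  else maxn (al r) (be r.+1) + (if r == i then u else minn (be r) (al r.-1)) - ka r.

Hypotheses (al_ka : forall r, al r <= ka r) (ka_be : forall r, ka r <= be r).
Hypotheses (ka_al : forall r, ka r.+1 <= al r) (be_ka : forall r, be r.+1 <= ka r).
Variables (i u : nat).
Hypotheses (u_be : u <= be i) (u_al : 0 < i -> u <= al i.-1) (ka_u : ka i <= u).

Lemma toggle_al r : al r <= toggle i u r.
Proof.
rewrite /toggle; case: ltngtP => [//|lt_i|->].
  case: r lt_i => // r _ /=; have := ka_be r.+1; have := ka_al r; lia.
by lia.
Qed.

Lemma toggle_be_lb r : be r.+1 <= toggle i u r.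
Proof.
rewrite /toggle; case: ltngtP => [//|lt_i|->].
  case: r lt_i => // r _ /=; have := ka_be r.+1; have := ka_al r; lia.
by lia.
Qed.

Lemma toggle_be r : toggle i u r <= be r.
Proof.
rewrite /toggle; case: ltngtP => [//|lt_i|->].
  by have := be_ka r; have := al_ka r; lia.
by have := be_ka i; have := al_ka i; lia.
Qed.

Lemma toggle_ub r : toggle i u r.+1 <= al r.
Proof.
rewrite /toggle; case: ltngtP => [//|lt_i|eq_i].
  by have := be_ka r.+1; have := al_ka r.+1; rewrite /=; lia.
by rewrite eq_i; have := be_ka i; have := al_ka i; move: u_al; rewrite -eq_i /=; lia.
Qed.

Lemma toggle_u : toggle i u i <= u.
Proof. by rewrite /toggle ltnn eqxx; have := be_ka i; have := al_ka i; lia. Qed.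

(** The two ends of the intervals of consecutive rows pair up as [maxn a b +
    minn b a = a + b], so that reversing all intervals sends the size of [ka]
    to its mirror image with respect to the sizes of [al] and [be]. *)
Lemma sum_toggle R : i < R ->
  \sum_(r < R) toggle i u r + \sum_(r < R) ka r
    + \sum_(r < i.+1) be r + \sum_(r < i) al r
  = \sum_(r < R) al r + \sum_(r < R.+1) be r + u + (\sum_(r < i) ka r).*2
    - minn (be R) (al R.-1).
Proof.
move=> lt_iR.
have sum_lt m : m <= i -> \sum_(r < m) toggle i u r = \sum_(r < m) ka r.
  by move=> le_m; apply: eq_bigr => r _; rewrite /toggle (leq_trans (ltn_ord r) le_m).
suff: \sum_(r < R) toggle i u r + \sum_(r < R) ka r
    + \sum_(r < i.+1) be r + \sum_(r < i) al r + minn (be R) (al R.-1)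
  = \sum_(r < R) al r + \sum_(r < R.+1) be r + u + (\sum_(r < i) ka r).*2 by lia.
elim: R lt_iR => // R IH; rewrite ltnS leq_eqVlt => /orP[/eqP <-|lt_iR].
  rewrite !big_ord_recr /= sum_lt // {1}/toggle ltnn eqxx.
  have := al_ka i; have := be_ka i; move: ka_u.
  by move: (\sum_(r < i) ka r) (\sum_(r < i) al r) (\sum_(r < i) be r); clear; lia.
have {IH} := IH lt_iR; rewrite !(big_ord_recr R.+1, big_ord_recr R) /=.
rewrite [toggle _ _ R]/toggle ltnNge (ltnW lt_iR) /= gtn_eqF //.
have := al_ka R; have := be_ka R; have := ka_be R.
case: R lt_iR => // R _; have := ka_al R => /=; lia.
Qed.

End Toggle.

Lemma toggleK al ka be i u :
    (forall r, al r <= ka r) -> (forall r, ka r <= be r) ->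
    (forall r, ka r.+1 <= al r) -> (forall r, be r.+1 <= ka r) ->
    ka i <= u ->
  forall r, toggle al (toggle al ka be i u) be i u r = ka r.
Proof.
move=> al_ka ka_be ka_al be_ka ka_u r; rewrite /toggle.
case: ltngtP => [//|lt_i|->]; have := al_ka r; have := be_ka r; have := ka_be r; last first.
  by have := al_ka i; have := be_ka i; lia.
by case: r lt_i => // r _; have := ka_al r; rewrite /=; lia.
Qed.

Definition set_level (g : nat -> nat -> nat) l (h : nat -> nat) k r :=
  if k == l.+1 then h r else g k r.

Lemma gt_set_level n th la g l h : l.+1 < n -> gt_pattern n th la g ->
    (forall r, g l r <= h r) -> (forall r, h r <= g l.+2 r) ->
    (forall r, h r.+1 <= g l r) -> (forall r, g l.+2 r.+1 <= h r) ->
  gt_pattern n th la (set_level g l h).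
Proof.
move=> lt_l [g0 gn g_row g_col] h1 h2 h3 h4; rewrite /set_level; split=> [//|r|k r lt_k|k r lt_k].
- by rewrite gtn_eqF.
- rewrite eqSS; case: (eqVneq k l) => [->|]; first by rewrite ltn_eqF.
  by case: (eqVneq k l.+1) => [->|_ _]; rewrite ?g_row // .
- rewrite eqSS; case: (eqVneq k l) => [->|]; first by rewrite ltn_eqF.
  by case: (eqVneq k l.+1) => [->|_ _]; rewrite ?g_col //.
Qed.

(** * Toggling a level of a tableau *)

Lemma card_le_inj (X Y : finType) (A : {set X}) (B : {set Y}) (f : X -> Y) (g : Y -> X) :
  {in A, forall x, f x \in B} -> {in A, cancel f g} -> #|A| <= #|B|.
Proof.
move=> fAB fK; rewrite -(card_in_imset (can_in_inj fK)); apply: subset_leq_card.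
by apply/subsetP=> _ /imsetP[x Ax ->]; exact: fAB.
Qed.

Section Flip.

Variables (n : nat) (th la : seq nat).
Hypotheses (th_part : is_part th) (la_part : is_part la) (la_th : included la th).
Implicit Type T : {ffun box th la -> 'I_n.+1}.

Definition toggle_tab T l i u : {ffun box th la -> 'I_n.+1} :=
  tab n th la (set_level (pat T) l
                 (toggle (pat T l) (pat T l.+1) (pat T l.+2) i u)).

Section OneToggle.

Variables (T : {ffun box th la -> 'I_n.+1}) (l i u : nat).
Hypotheses (ss : semistandard T) (lt_l : l < n) (lt_i : i <= size th).
Hypotheses (u_be : u <= pat T l.+2 i) (u_al : 0 < i -> u <= pat T l i.-1).
Hypothesis ka_u : pat T l.+1 i <= u.
Let T' := toggle_tab T l i u.

Let al_ka r : pat T l r <= pat T l.+1 r.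
Proof. exact: pat_mono. Qed.
Let ka_be r : pat T l.+1 r <= pat T l.+2 r.
Proof. exact: pat_mono. Qed.
Let ka_al r : pat T l.+1 r.+1 <= pat T l r.
Proof. by case: (pat_gt th_part la_part la_th ss) => _ _ _; apply; rewrite ltnS // ltnW. Qed.
Let be_ka r : pat T l.+2 r.+1 <= pat T l.+1 r.
Proof. by case: (pat_gt th_part la_part la_th ss) => _ _ _; apply; rewrite ltnS // ltnW. Qed.

Lemma toggle_tab_gt : gt_pattern n.+1 th la (set_level (pat T) l
                 (toggle (pat T l) (pat T l.+1) (pat T l.+2) i u)).
Proof.
apply: gt_set_level => // [|r|r|r|r]; first exact: pat_gt.
- exact: toggle_al.
- exact: toggle_be.
- exact: toggle_ub.
- exact: toggle_be_lb.
Qed.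

Lemma toggle_tab_ss : semistandard T'.
Proof. exact: tab_semistandard toggle_tab_gt. Qed.

Lemma pat_toggle_tab k r : k <= n.+1 -> pat T' k r =
  set_level (pat T) l (toggle (pat T l) (pat T l.+1) (pat T l.+2) i u) k r.
Proof. by move=> le_k; apply: pat_tab => //; exact: toggle_tab_gt. Qed.

Lemma pat_toggle_neq k r : k <= n.+1 -> k != l.+1 -> pat T' k r = pat T k r.
Proof. by move=> le_k /negbTE neq_k; rewrite pat_toggle_tab // /set_level neq_k. Qed.

Lemma pat_toggle_eq r : pat T' l.+1 r =
  toggle (pat T l) (pat T l.+1) (pat T l.+2) i u r.
Proof. by rewrite pat_toggle_tab /set_level ?eqxx // ltnS ltnW. Qed.

Lemma toggle_tab_fixed r : r < i -> pat T' l.+1 r = pat T l.+1 r.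
Proof. by rewrite pat_toggle_eq /toggle => ->. Qed.

Lemma toggle_tab_le : pat T' l.+1 i <= u.
Proof. by rewrite pat_toggle_eq; exact: toggle_u. Qed.

Lemma weight_toggle_neq (k : 'I_n.+1) : k != l :> nat -> k != l.+1 :> nat ->
  weight T' k = weight T k.
Proof.
move=> neq_l neq_l1; have := sum_pat_weight T' k (leqnn (size th)).
rewrite [X in X = _](eq_bigr (fun r : 'I__ => pat T k.+1 r)); last first.
  by move=> r _; rewrite pat_toggle_neq ?eqSS.
rewrite [X in _ = X + _](eq_bigr (fun r : 'I__ => pat T k r)); last first.
  by move=> r _; rewrite pat_toggle_neq // ltnW.
by rewrite (sum_pat_weight T k (leqnn (size th))) => /addnI.
Qed.

(** The equations are written without subtraction. For the full toggle all
    terms other than the weights cancel, so that the two weights are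
    exchanged. *)
Lemma weight_toggle (k0 k1 : 'I_n.+1) : k0 = l :> nat -> k1 = l.+1 :> nat ->
  weight T' k0 + \sum_(r < i.+1) pat T l.+2 r + \sum_(r < i) pat T l r =
    weight T k1 + u + (\sum_(r < i) pat T l.+1 r).*2 /\
  weight T' k1 + u + (\sum_(r < i) pat T l.+1 r).*2 =
    weight T k0 + \sum_(r < i.+1) pat T l.+2 r + \sum_(r < i) pat T l r.
Proof.
move=> def_k0 def_k1; have le_R := leqnSn (size th).
have := sum_toggle al_ka ka_be ka_al be_ka u_be u_al ka_u (lt_i : i < (size th).+1).
have end0 : pat T l.+2 (size th).+1 = 0.
  have := pat_le th_part la_th T l.+2 (size th).+1.
  by rewrite nth_default // leqn0 => /eqP.
rewrite [in X in _ = X](big_ord_recr (size th).+1) /= end0 min0n subn0 addn0.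
have := sum_pat_weight T k0 le_R; have := sum_pat_weight T k1 le_R.
have := sum_pat_weight T' k0 le_R; have := sum_pat_weight T' k1 le_R.
rewrite def_k0 def_k1.
have sum_neq k : k <= n.+1 -> k != l.+1 ->
    \sum_(r < (size th).+1) pat T' k r = \sum_(r < (size th).+1) pat T k r.
  by move=> le_k neq_k; apply: eq_bigr => r _; exact: pat_toggle_neq.
rewrite (sum_neq l.+2) ?(sum_neq l) ?(ltn_eqF (ltnSn _)) ?(gtn_eqF (ltnSn _)) //; [|lia..].
rewrite (eq_bigr _ (fun (r : 'I__) _ => pat_toggle_eq r)).
move: (\sum_(r < _) toggle _ _ _ _ _ _) => S'.
move: (\sum_(r < (size th).+1) pat T l r) (\sum_(r < (size th).+1) pat T l.+1 r).
move: (\sum_(r < (size th).+1) pat T l.+2 r) (\sum_(r < i) pat T l r).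
move: (\sum_(r < i) pat T l.+1 r) (\sum_(r < i.+1) pat T l.+2 r).
move: (weight T' k0) (weight T' k1) (weight T k0) (weight T k1); clear; lia.
Qed.

End OneToggle.

Lemma toggle_tabK T l i u : semistandard T -> l < n ->
    u <= pat T l.+2 i -> (0 < i -> u <= pat T l i.-1) -> pat T l.+1 i <= u ->
  toggle_tab (toggle_tab T l i u) l i u = T.
Proof.
move=> ss lt_l u_be u_al ka_u; have ss' := toggle_tab_ss ss lt_l u_be u_al ka_u.
(* The neighbouring levels, and with them all interval ends, are unchanged. *)
have neq := pat_toggle_neq ss lt_l u_be u_al ka_u.
have eq_l := pat_toggle_eq ss lt_l u_be u_al ka_u.
have be' r : pat (toggle_tab T l i u) l.+2 r = pat T l.+2 r by apply: neq => //; lia.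
have al' r : pat (toggle_tab T l i u) l r = pat T l r by apply: neq => //; lia.
have u_be' : u <= pat (toggle_tab T l i u) l.+2 i by rewrite be'.
have u_al' : 0 < i -> u <= pat (toggle_tab T l i u) l i.-1 by rewrite al'.
have ka_u' := toggle_tab_le ss lt_l u_be u_al ka_u.
have gP := pat_gt th_part la_part la_th ss; case: (gP) => _ _ _ g_col.
apply: (pat_inj th_part la_part la_th); [exact: toggle_tab_ss | exact: ss | move=> k r le_k].
case: (eqVneq k l.+1) => [->|neq_k]; last by rewrite pat_toggle_neq // neq.
rewrite pat_toggle_eq //.
rewrite -[RHS](@toggleK (pat T l) (pat T l.+1) (pat T l.+2) i u) //.
- by rewrite /toggle !al' !be' eq_l.
- by move=> r'; exact: pat_mono.
- by move=> r'; exact: pat_mono.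
- by move=> r'; apply: g_col; lia.
- by move=> r'; apply: g_col; lia.
Qed.

End Flip.

(** * Symmetry of skew Kostka numbers in the content *)

Definition skew_kostka n th la (c : 'I_n -> int) : nat :=
  #|[set T : {ffun box th la -> 'I_n} |
      semistandard T && [forall k, Posz (weight T k) == c k]]|.

Lemma eq_skew_kostka n th la (c d : 'I_n -> int) : c =1 d ->
  skew_kostka th la c = skew_kostka th la d.
Proof.
move=> eq_cd; apply: eq_card => T; rewrite !inE; congr (_ && _).
by apply: eq_forallb => k; rewrite eq_cd.
Qed.

(** The transposition of [i] and [j] is the conjugate of that of [i] and [j -
    1] by the transposition of [j - 1] and [j]. *)
Lemma adjacent_tperm_ind n (P : 'S_n -> Prop) :
    P 1%g -> (forall u v, P u -> P v -> P (u * v)%g) ->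
    (forall i j : 'I_n, j = i.+1 :> nat -> P (tperm i j)) ->
  forall w, P w.
Proof.
move=> P1 PM Padj.
have Pt m (i j : 'I_n) : j = i + m.+1 :> nat -> P (tperm i j).
  elim: m j => [|m IH] j def_j; first by apply: Padj; rewrite def_j addn1.
  have lt_k : i + m.+1 < n by rewrite (leq_trans _ (ltn_ord j)) // def_j; lia.
  pose k := Ordinal lt_k.
  have -> : tperm i j = (tperm k j * (tperm i k * tperm k j))%g.
    rewrite -[X in (X * _)%g]tpermV -conjgE tpermJ tpermL tpermD // -val_eqE /=; lia.
  by apply: (PM); [|apply: (PM)]; [apply: Padj | exact: IH | apply: Padj]; rewrite /=; lia.
have Pall (i j : 'I_n) : P (tperm i j).
  case: (ltngtP i j) => [lt_ij|lt_ji|/val_inj <-]; last by rewrite tperm1.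
    by apply: (Pt (j - i.+1)); lia.
  by rewrite tpermC; apply: (Pt (i - j.+1)); lia.
move=> w; have [ts -> _] := prod_tpermP w.
by elim: ts => [|t ts IH]; rewrite ?big_nil // big_cons; exact: PM.
Qed.

Section Symmetry.

Variables (n : nat) (th la : seq nat).
Hypotheses (th_part : is_part th) (la_part : is_part la) (la_th : included la th).

(** The full toggle of the level between the letters [i] and [j] exchanges the
    numbers of their occurrences and keeps all others. *)
Lemma skew_kostka_adjacent (c : 'I_n.+1 -> int) (i j : 'I_n.+1) :
  j = i.+1 :> nat -> skew_kostka th la (c \o tperm i j) = skew_kostka th la c.
Proof.
move=> def_j.
suff le d : skew_kostka th la d <= skew_kostka th la (d \o tperm i j).
  apply/eqP; rewrite eqn_leq le andbT; apply: leq_trans (le _) _.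
  by rewrite (eq_skew_kostka _ _ (d := c)) // => k /=; rewrite tpermK.
have lt_i : i < n by have := ltn_ord j; rewrite def_j.
pose f (T : {ffun box th la -> 'I_n.+1}) := toggle_tab T i 0 (pat T i.+2 0).
have ka_u (T : {ffun box th la -> 'I_n.+1}) : pat T i.+1 0 <= pat T i.+2 0.
  exact: pat_mono.
apply: (@card_le_inj _ _ _ _ f f) => T; rewrite !inE => /andP[ss /forallP wt]; last first.
  rewrite {1}/f pat_toggle_neq //; first exact: toggle_tabK.
  by rewrite gtn_eqF.
rewrite toggle_tab_ss //=; apply/forallP=> k /=.
have u_al : 0 < 0 -> pat T i.+2 0 <= pat T i 0.-1 by [].
have [] := weight_toggle th_part la_part la_th ss lt_i (leq0n _) (leqnn _) u_al (ka_u T)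
  (erefl _) def_j.
rewrite big_ord1 !big_ord0 /= -/(f T) => w_i w_j.
case: tpermP => [->|->|/eqP neq_i /eqP neq_j].
- by rewrite -(eqP (wt j)); apply/eqP; congr Posz; move: w_i w_j; clear; lia.
- by rewrite -(eqP (wt i)); apply/eqP; congr Posz; move: w_i w_j; clear; lia.
rewrite -(eqP (wt k)) weight_toggle_neq // -?def_j //.
Qed.

Lemma skew_kostka_perm (c : 'I_n.+1 -> int) (w : 'S_n.+1) :
  skew_kostka th la (c \o w) = skew_kostka th la c.
Proof.
move: w c; apply: adjacent_tperm_ind => [c|u v IHu IHv c|i j def_j c].
- by apply: eq_skew_kostka => k /=; rewrite perm1.
- rewrite -[RHS]IHv -[RHS]IHu; apply: eq_skew_kostka => k /=; by rewrite permM.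
- exact: skew_kostka_adjacent.
Qed.

End Symmetry.

(** * The sign-reversing involution behind the Littlewood-Richardson rule *)

(** The vector [v + delta]. *)
Definition delta_shift n (v : 'I_n -> nat) (i : 'I_n) : int := Posz (v i + (n.-1 - i)).

(** The coefficient of [x ^ a] in the alternant [\sum_w (-1) ^+ w * x ^ (w
    v)]. *)
Definition alt_sign n (v a : 'I_n -> int) : int :=
  (\sum_(w : 'S_n) (-1) ^+ w * [forall i, a (w i) == v i]%:R)%R.

Lemma eq_alt_sign n (v v' a : 'I_n -> int) : v =1 v' -> alt_sign v a = alt_sign v' a.
Proof.
move=> eq_v; apply: eq_bigr => w _; congr (_ * _%:R)%R; congr nat_of_bool.
by apply: eq_forallb => i; rewrite eq_v.
Qed.

Lemma alt_sign_tperm n (v a : 'I_n -> int) (k l : 'I_n) : k != l ->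
  alt_sign (v \o tperm k l) a = (- alt_sign v a)%R.
Proof.
move=> neq_kl; rewrite /alt_sign (reindex_inj (mulgI (tperm k l))) /= -sumrN.
apply: eq_bigr => w _; rewrite odd_mul_tperm neq_kl signr_addb mulN1r mulNr.
congr (- (_ * _%:R))%R; congr nat_of_bool; apply/forallP/forallP=> /= eq_v i.
  by have := eq_v (tperm k l i); rewrite permM tpermK.
by rewrite permM; exact: eq_v.
Qed.

(** Failure of the lattice condition for the letters [l] and [l.+1] when rows
    [0] to [i] have been read up to the last occurrence of [l.+1] in row [i].
    Rows are read from right to left, so no [l] of row [i] has been met by
    then. *)
Definition lattice_fails n th la (T : {ffun box th la -> 'I_n}) (l i : nat) : bool :=
  #|[set b | (row_of b < i) && (T b == l :> nat)]| <
  #|[set b | (row_of b < i.+1) && (T b == l.+1 :> nat)]|.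

Lemma sum_pat_letter n th la (T : {ffun box th la -> 'I_n}) l i :
  \sum_(r < i) pat T l.+1 r =
  \sum_(r < i) pat T l r + #|[set b | (row_of b < i) && (T b == l :> nat)]|.
Proof.
rewrite !sum_pat -addnA; congr (_ + _).
by apply: card_addb => b /=; case: (_ < _) => //=; rewrite ltnS; case: ltngtP.
Qed.

Lemma lattice_failsE n th la (T : {ffun box th la -> 'I_n}) l i :
  lattice_fails T l i =
  (\sum_(r < i) pat T l.+1 r + \sum_(r < i.+1) pat T l.+1 r <
   \sum_(r < i) pat T l r + \sum_(r < i.+1) pat T l.+2 r).
Proof.
rewrite (sum_pat_letter T l i) (sum_pat_letter T l.+1 i.+1) /lattice_fails.
by rewrite -addnA ltn_add2l addnC ltn_add2l.
Qed.

Definition lattice_rows n th la (T : {ffun box th la -> 'I_n}) : bool :=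
  [forall i : 'I_(size th), forall l : 'I_n, ~~ lattice_fails T l i].

(** Among the failures [(i, l)] the smallest row [i] is taken, and in it the
    largest letter [l]. Changing level [l.+1] in the rows from [i] on affects,
    in row [i], the conditions for [l] and for [l.-1] only; hence the choice
    is not disturbed by what happens to smaller letters. *)
Definition first_failure n th la (T : {ffun box th la -> 'I_n}) (p : 'I_(size th) * 'I_n) :=
  [&& lattice_fails T p.2 p.1,
      [forall i : 'I_(size th), forall l : 'I_n, (i < p.1) ==> ~~ lattice_fails T l i]
    & [forall l : 'I_n, (p.2 < l) ==> ~~ lattice_fails T l p.1]].

Lemma first_failure_inj n th la (T : {ffun box th la -> 'I_n}) p q :
  first_failure T p -> first_failure T q -> p = q.
Proof.
case: p q => [i l] [i' l'] /and3P[/= f1 /forallP up1 /forallP r1].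
case/and3P=> /= f2 /forallP up2 /forallP r2.
have eq_i : i = i'.
  apply: val_inj; case: (ltngtP i i') => // lt_i.
    by have /forallP/(_ l) := up2 i; rewrite lt_i f1.
  by have /forallP/(_ l') := up1 i'; rewrite lt_i f2.
rewrite -eq_i in f2 r2 *; congr (_, _).
apply: val_inj; case: (ltngtP l l') => // lt_l.
  by have := r1 l'; rewrite lt_l f2.
by have := r2 l; rewrite lt_l f1.
Qed.

Lemma first_failure_ex n th la (T : {ffun box th la -> 'I_n}) :
  ~~ lattice_rows T -> exists p, first_failure T p.
Proof.
rewrite negb_forall => /existsP[i0]; rewrite negb_forall => fail0.
pose P (i : 'I_(size th)) := [exists l : 'I_n, lattice_fails T l i].
have P0 : P i0 by case/existsP: fail0 => l; rewrite negbK => f; apply/existsP; exists l.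
case: (arg_minnP (fun i : 'I_(size th) => i : nat) P0) => i /existsP[l0 f0] i_min.
case: (@arg_maxnP _ l0 (fun l : 'I_n => lattice_fails T l i) (fun l => l : nat) f0) => l f l_max.
exists (i, l); rewrite /first_failure /= f /=; apply/andP; split.
  apply/forallP=> i'; apply/forallP=> l'; apply/implyP; apply: contraTN => f'.
  by rewrite -leqNgt i_min //; apply/existsP; exists l'.
by apply/forallP=> l'; apply/implyP; apply: contraTN => f'; rewrite -leqNgt; exact: l_max.
Qed.

Section Cancellation.

Variables (n : nat) (th la : seq nat).
Hypotheses (th_part : is_part th) (la_part : is_part la) (la_th : included la th).
Implicit Type T : {ffun box th la -> 'I_n.+1}.

(** Let [d] be the surplus of [l] over [l.+1] in the rows before [i]. The
    [d.+1] rightmost entries [l.+1] of row [i], which cause the failure, are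
    set aside; the rest of row [i] then ends at [flip_top T l i]. *)
Definition flip_top T (l i : nat) : nat :=
  (\sum_(r < i) pat T l r + \sum_(r < i.+1) pat T l.+2 r
    - (\sum_(r < i) pat T l.+1 r).*2).-1.

Definition flip (p : 'I_(size th) * 'I_n.+1) T :=
  toggle_tab T p.2 p.1 (flip_top T p.2 p.1).

Section Flip.

Variables (T : {ffun box th la -> 'I_n.+1}) (p : 'I_(size th) * 'I_n.+1).
Hypotheses (ss : semistandard T) (ff : first_failure T p).
Let i : nat := p.1.
Let l : nat := p.2.
Let u := flip_top T l i.

Lemma flip_letter : l < n.
Proof.
have /and3P[f _ _] := ff; rewrite ltnNge; apply/negP=> le_nl.
move: f; rewrite /lattice_fails (_ : [set b | _ && (T b == p.2.+1 :> nat)] = set0) ?cards0 //.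
apply/setP=> b; rewrite !inE; apply/negbTE; rewrite negb_and orbC neq_ltn.
by rewrite (leq_trans (ltn_ord _)).
Qed.

Lemma flip_topE : (flip_top T l i).+1 + (\sum_(r < i) pat T l.+1 r).*2 =
  \sum_(r < i) pat T l r + \sum_(r < i.+1) pat T l.+2 r.
Proof.
have /and3P[f _ _] := ff; move: f; rewrite lattice_failsE -/i -/l /flip_top.
by rewrite (big_ord_recr i) /=; lia.
Qed.

Lemma flip_ka_u : pat T l.+1 i <= u.
Proof.
have /and3P[f _ _] := ff; move: f; rewrite lattice_failsE -/i -/l.
by have := flip_topE; rewrite /u (big_ord_recr i (fun r => pat T l.+1 r)) /=; lia.
Qed.

Lemma flip_no_failure : 0 < i ->
  \sum_(r < i.-1) pat T l r + \sum_(r < i.-1.+1) pat T l.+2 r <=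
  \sum_(r < i.-1) pat T l.+1 r + \sum_(r < i.-1.+1) pat T l.+1 r.
Proof.
move=> i_gt0; have /and3P[_ /forallP up _] := ff.
have lt_i : i.-1 < size th by rewrite (leq_ltn_trans (leq_pred _)) // ltn_ord.
have /forallP/(_ p.2)/implyP := up (Ordinal lt_i); rewrite /= ltn_predL => /(_ i_gt0).
by rewrite lattice_failsE -leqNgt.
Qed.

(** The second bound is where the minimality of the row is used: as the
    condition held in row [i.-1], the surplus [d] is at least the number of
    [l] in row [i.-1], so that the [d.+1] entries set aside reach past every
    column of row [i] that has an entry [l] above it. *)
Lemma flip_u_bounds : (u <= pat T l.+2 i) /\ (0 < i -> u <= pat T l i.-1).
Proof.
have lt_l := flip_letter; have := flip_topE; rewrite -/u.
have [_ _ _ g_col] := pat_gt th_part la_part la_th ss.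
case: (posnP i) => [-> |i_gt0].
  by rewrite !big_ord0 big_ord1 /=; lia.
have := flip_no_failure i_gt0.
have := g_col l.+1 i.-1 lt_l; have := pat_mono T i.-1 (leqnSn l).
rewrite -[in X in _ -> _ -> _ -> X](prednK i_gt0) !big_ord_recr /=.
rewrite prednK //; lia.
Qed.

Let T' := flip p T.
Let lt_l : l < n := flip_letter.
Let u_be : u <= pat T l.+2 i := flip_u_bounds.1.
Let u_al : 0 < i -> u <= pat T l i.-1 := flip_u_bounds.2.
Let lt_i : i <= size th := ltnW (ltn_ord p.1).

Lemma flip_ss : semistandard T'.
Proof. exact: toggle_tab_ss flip_ka_u. Qed.

Lemma pat_flip_neq k r : k != l.+1 -> pat T' k r = pat T k r.
Proof.
case: (leqP k n.+1) => le_k neq_k; first exact: pat_toggle_neq flip_ka_u _ _ _ _.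
by rewrite !pat_end // ltnW.
Qed.

Lemma pat_flip_row k r : r < i -> pat T' k r = pat T k r.
Proof.
case: (eqVneq k l.+1) => [-> lt_r|neq_k _]; last exact: pat_flip_neq.
exact: toggle_tab_fixed flip_ka_u _ lt_r.
Qed.

Lemma sum_flip_neq m k : k != l.+1 -> \sum_(r < m) pat T' k r = \sum_(r < m) pat T k r.
Proof. by move=> neq_k; apply: eq_bigr => r _; exact: pat_flip_neq. Qed.

Lemma sum_flip_row m k : m <= i -> \sum_(r < m) pat T' k r = \sum_(r < m) pat T k r.
Proof.
by move=> le_m; apply: eq_bigr => r _; apply: pat_flip_row; exact: leq_trans le_m.
Qed.

Lemma flip_top_flip : flip_top T' l i = u.
Proof.
by rewrite /u /flip_top (sum_flip_neq i.+1) ?gtn_eqF // !sum_flip_row.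
Qed.

(** Reversal in row [i] stays below [flip_top], which is precisely the
    condition for a failure there. *)
Lemma flip_first_failure : first_failure T' p.
Proof.
have /and3P[f /forallP up /forallP right] := ff; apply/and3P; split.
- rewrite lattice_failsE -/i -/l.
  have := toggle_tab_le th_part la_part la_th ss lt_l u_be u_al flip_ka_u.
  rewrite -/(flip p T) -/T' => le_u.
  have := flip_topE; rewrite -/u (sum_flip_neq i.+1 (k := l.+2)) ?gtn_eqF //.
  rewrite !(big_ord_recr i) /= !sum_flip_row //.
  move: le_u; move: (pat T' l.+1 i) (u) (\sum_(r < i) pat T l.+1 r).
  by move: (\sum_(r < i) pat T l r + _); clear; lia.
- apply/forallP=> i'; apply/forallP=> l'; apply/implyP=> lt_i'.
  have /forallP/(_ l')/implyP/(_ lt_i') := up i'.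
  by rewrite !lattice_failsE !(sum_flip_row _ lt_i') !(sum_flip_row _ (ltnW lt_i')).
apply/forallP=> l'; apply/implyP=> lt_l'.
have := right l'; rewrite lt_l' /= !lattice_failsE.
have n1 : l'.+1 != l.+1 by rewrite eqSS gtn_eqF.
have n2 : l'.+2 != l.+1 by rewrite eqSS gtn_eqF // ltnS ltnW.
by rewrite !(sum_flip_row _ (leqnn i)) !sum_flip_neq.
Qed.

Lemma flipK : flip p T' = T.
Proof. by rewrite /flip flip_top_flip; exact: toggle_tabK flip_ka_u. Qed.

(** The part of the tableau read before and including the failure contains one
    [l.+1] more than [l], and on the remaining part the numbers of [l] and
    [l.+1] are exchanged. In total the weights are exchanged up to a
    correction by one, which [delta] absorbs. *)
Lemma delta_shift_flip (k : 'I_n.+1) : k = l.+1 :> nat ->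
  delta_shift (weight T') =1 delta_shift (weight T) \o tperm p.2 k.
Proof.
move=> def_k j; rewrite /delta_shift /=.
have [] := weight_toggle th_part la_part la_th ss lt_l lt_i u_be u_al flip_ka_u (erefl _) def_k.
rewrite -/(flip p T) -/T'; have := flip_topE; rewrite -/u => def_u w_l w_k.
case: tpermP => [->|->|/eqP neq_l /eqP neq_k].
- by congr Posz; move: lt_l def_k def_u w_l w_k; rewrite /l; clear; lia.
- by congr Posz; move: lt_l def_k def_u w_l w_k; rewrite /l; clear; lia.
congr (Posz (_ + _)).
rewrite (weight_toggle_neq th_part la_part la_th ss lt_l u_be u_al flip_ka_u) //.
by rewrite -def_k.
Qed.

End Flip.

(** Tableaux violating the lattice condition are sorted by their first
    failure; [flip] is an involution on each class which changes the sign of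
    every summand. *)
Lemma alt_sum_lattice (a : 'I_n.+1 -> int) :
  (\sum_(T : {ffun box th la -> 'I_n.+1} | semistandard T)
     alt_sign (delta_shift (weight T)) a =
   \sum_(T : {ffun box th la -> 'I_n.+1} | semistandard T && lattice_rows T)
     alt_sign (delta_shift (weight T)) a)%R.
Proof.
rewrite (bigID (@lattice_rows _ _ _)) /=.
rewrite [X in (_ + X)%R](_ : _ = 0%R) ?addr0 //.
(* It remains to see that the tableaux violating the condition cancel. *)
pose ff T := [pick p | first_failure T p].
rewrite (partition_big ff predT) //= big1 // => -[p|] _; last first.
  rewrite big_pred0 // => T; apply/negbTE; rewrite negb_and.
  case: (boolP (lattice_rows T)) => [|/first_failure_ex[p fp]]; first by rewrite andbF.
  by rewrite /ff; case: pickP => [p' _|/(_ p)]; rewrite ?fp ?orbT.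
rewrite (eq_bigl (fun T => semistandard T && first_failure T p)) => [|T]; last first.
  rewrite /ff -andbA; case: (semistandard T) => //=; case: pickP => [q fq|no_ff].
    case: (eqVneq q p) => [<-|/eqP neq_q]; last first.
      rewrite (_ : Some q == Some p = false) ?andbF; last by apply/eqP => -[].
      by apply/esym/negbTE/negP => fp; case: neq_q; exact: first_failure_inj fq fp.
    rewrite eqxx andbT fq; case/and3P: fq => fail _ _; apply/forallPn.
    by exists q.1; apply/forallPn; exists q.2; rewrite negbK.
  by rewrite andbF no_ff.
set S := (\sum_(T | _) _)%R.
suff: (S = - S)%R by lia.
rewrite {1}/S (reindex_onto (flip p) (flip p)) /= => [|T /andP[ss fp]]; last exact: flipK.
rewrite (eq_bigl (fun T => semistandard T && first_failure T p)) => [|T]; last first.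
  apply/andP/andP => [[/andP[ss fp] /eqP fK]|[ss fp]].
    by have := flip_ss ss fp; have := flip_first_failure ss fp; rewrite fK => -> ->.
  by rewrite flip_ss // flip_first_failure // flipK.
rewrite /S -sumrN; apply: eq_bigr => T /andP[ss fp].
have lt_l : p.2.+1 < n.+1 by rewrite ltnS (flip_letter fp).
rewrite (eq_alt_sign _ (delta_shift_flip ss fp (erefl _ : Ordinal lt_l = p.2.+1 :> nat))).
by rewrite alt_sign_tperm // -val_eqE /= ltn_eqF.
Qed.

End Cancellation.

(** Within a row it is enough to stop at the leftmost occurrence of a letter,
    where the condition is the strongest. In a row without [l.+1] the
    condition follows from the previous rows. *)
Lemma lattice_wordE n th la (T : {ffun box th la -> 'I_n}) : semistandard T ->
  lattice_word T = lattice_rows T.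
Proof.
move=> ss; have /semistandardP[ssr _] := ss.
apply/forallP/forallP => [lat i|rows b].
  apply/forallP=> l; rewrite /lattice_fails -leqNgt.
  have reduce m (b0 : box th la) : row_of b0 = m -> T b0 = l.+1 :> nat ->
      #|[set b | (row_of b < m.+1) && (T b == l.+1 :> nat)]| <=
      #|[set b | (row_of b < m) && (T b == l :> nat)]|.
    move=> row_b0 T_b0.
    pose P b := (row_of b == m) && (T b == l.+1 :> nat).
    have P0 : P b0 by rewrite /P row_b0 T_b0 !eqxx.
    case: (arg_minnP (@col_of th la) P0) => b /andP[/eqP row_b /eqP T_b] b_min.
    have /forallP/(_ l)/forallP/(_ (T b))/implyP/(_ (introT eqP T_b)) := lat b.
    move=> le_read; apply: leq_trans (leq_trans le_read _).
      apply: subset_leq_card; apply/subsetP=> c; rewrite !inE -val_eqE /= T_b row_b ltnS.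
      case/andP=> le_c T_c; rewrite T_c /=; case: ltngtP le_c => //= row_c _.
      by apply: b_min; rewrite /P row_c T_c eqxx.
    apply: subset_leq_card; apply/subsetP=> c; rewrite !inE -val_eqE /= row_b andbC.
    case/andP=> /orP[->|/andP[/eqP row_c le_c]] /eqP T_c; first by rewrite T_c eqxx.
    by have := ssr b c; rewrite row_b row_c T_b T_c ltnn => /(_ erefl le_c).
  have reduce0 m : (forall b, row_of b = m -> T b <> l.+1 :> nat) ->
      [set b | (row_of b < m.+1) && (T b == l.+1 :> nat)] =
      [set b | (row_of b < m) && (T b == l.+1 :> nat)].
    move=> no_b; apply/setP=> b; rewrite !inE ltnS; case: ltngtP => //= row_b.
    by apply/negbTE/eqP; exact: no_b.
  elim: (i : nat) => [|m IH] {i}.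
    case: (pickP (fun b => (row_of b == 0) && (T b == l.+1 :> nat))) => [b|no_b].
      by case/andP=> /eqP row_b /eqP T_b; exact: reduce T_b.
    rewrite reduce0 => [|b row_b T_b]; last by have := no_b b; rewrite row_b T_b !eqxx.
    by rewrite (_ : [set b | _] = set0) ?cards0 //; apply/setP=> b; rewrite !inE.
  case: (pickP (fun b => (row_of b == m.+1) && (T b == l.+1 :> nat))) => [b|no_b].
    by case/andP=> /eqP row_b /eqP T_b; exact: reduce T_b.
  rewrite reduce0 => [|b row_b T_b]; last by have := no_b b; rewrite row_b T_b !eqxx.
  apply: leq_trans IH _; apply: subset_leq_card; apply/subsetP=> b; rewrite !inE.
  by case/andP=> /ltnW lt_b ->; rewrite ltnS lt_b.
apply/forallP=> k; apply/forallP=> l; apply/implyP=> /eqP def_l.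
have /forallP/(_ k) := rows (Ordinal (row_lt b)).
rewrite /lattice_fails -leqNgt /= => le_rows; apply: leq_trans (leq_trans le_rows _).
  apply: subset_leq_card; apply/subsetP=> c; rewrite !inE -val_eqE /= def_l.
  case/andP=> -> row_c; rewrite andbT ltnS.
  by case/orP: row_c => [/ltnW|/andP[/eqP-> _]].
apply: subset_leq_card; apply/subsetP=> c; rewrite !inE -val_eqE /=.
by case/andP=> -> ->.
Qed.

(** * Littlewood-Richardson numbers and tableaux of straight shape *)

Lemma sum_weight n th la (T : {ffun box th la -> 'I_n}) : is_part th ->
  \sum_k weight T k = skew_size th la.
Proof.
move=> th_part; rewrite -card_box // -sum1_card (partition_big T predT) //=.
by apply: eq_bigr => k _; rewrite /weight -sum1_card; apply: eq_bigl => b; rewrite inE.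
Qed.

(** Further letters do not occur, so that tableaux for different [si] can be
    compared on one alphabet. *)
Lemma LR_coef_letters n th la si : included la th -> size si <= n ->
  LR_coef th la si =
  #|[set T : {ffun box th la -> 'I_n} |
      [&& semistandard T, lattice_word T & [forall k, weight T k == nth 0 si k]]]|.
Proof.
move=> la_th le_n; rewrite /LR_coef la_th.
pose f (T : {ffun box th la -> 'I_(size si)}) : {ffun box th la -> 'I_n} :=
  [ffun b => widen_ord le_n (T b)].
have fE T b : f T b = T b :> nat by rewrite ffunE.
have f_eq T b (k : 'I_n) : (f T b == k) = (T b == k :> nat) by rewrite -val_eqE /= fE.
have f_inj : injective f.
  by move=> T T' /ffunP eq_f; apply/ffunP=> b; apply: val_inj; rewrite /= -!fE eq_f.
rewrite -(card_imset _ f_inj); apply: eq_card => T; rewrite [in RHS]inE.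
have count_f T' b (k : 'I_n) (k' : 'I_(size si)) : k = k' :> nat ->
    read_count (f T') b k = read_count T' b k'.
  by move=> eq_k; apply: eq_card => c; rewrite !inE f_eq eq_k.
have weight_f T' (k : 'I_n) (k' : 'I_(size si)) : k = k' :> nat ->
    weight (f T') k = #|[set b | T' b == k']|.
  by move=> eq_k; apply: eq_card => c; rewrite !inE f_eq eq_k.
apply/imsetP/and3P => [[T']|[ss lat /forallP wt]].
  rewrite inE => /and3P[ss lat /forallP wt] ->; split.
  - by apply/forallP=> b; apply/forallP=> c; rewrite !fE; move/forallP/(_ b)/forallP/(_ c): ss.
  - apply/forallP=> b; apply/forallP=> k; apply/forallP=> l; apply/implyP=> /= /eqP def_l.
    case: (ltnP l (size si)) => [lt_l|le_l].
      have lt_k : k < size si by rewrite ltnW // -def_l.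
      rewrite (count_f _ _ l (Ordinal lt_l)) // (count_f _ _ k (Ordinal lt_k)) //.
      have /forallP/(_ (Ordinal lt_k))/forallP/(_ (Ordinal lt_l))/implyP := forallP lat b.
      by apply; apply/eqP.
    rewrite (_ : read_count _ _ l = 0) //; apply/eqP; rewrite cards_eq0; apply/eqP/setP=> c.
    by rewrite !inE f_eq ltn_eqF // (leq_trans _ le_l).
  apply/forallP=> k; case: (ltnP k (size si)) => [lt_k|le_k].
    by rewrite (weight_f _ k (Ordinal lt_k)) // (eqP (wt _)).
  rewrite nth_default // cards_eq0; apply/eqP/setP=> c.
  by rewrite !inE f_eq ltn_eqF // (leq_trans _ le_k).
have T_lt b : T b < size si.
  rewrite ltnNge; apply/negP=> le_b; have := wt (T b).
  by rewrite nth_default // cards_eq0 => /eqP/setP/(_ b); rewrite !inE eqxx.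
pose T' : {ffun box th la -> 'I_(size si)} := [ffun b => Ordinal (T_lt b)].
have def_T : T = f T' by apply/ffunP=> b; apply: val_inj; rewrite /= !ffunE.
exists T' => //; rewrite def_T in ss lat wt; rewrite inE; apply/and3P; split.
- by apply/forallP=> b; apply/forallP=> c; rewrite -!fE; move/forallP/(_ b)/forallP/(_ c): ss.
- apply/forallP=> b; apply/forallP=> k; apply/forallP=> l.
  rewrite -(count_f T' b (widen_ord le_n k) k) // -(count_f T' b (widen_ord le_n l) l) //.
  by have /forallP/(_ (widen_ord le_n k))/forallP/(_ (widen_ord le_n l)) := forallP lat b.
- by apply/forallP=> k; rewrite -(weight_f _ (widen_ord le_n k)) // wt.
Qed.

Lemma included_nil p : included [::] p.
Proof. by apply/includedP=> i; rewrite nth_nil. Qed.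

#[local] Hint Resolve included_nil : core.

Lemma skew_size_nil p : skew_size p [::] = sumn p.
Proof. by rewrite (sumn_nth (leqnn _)); apply: eq_bigr => i _; rewrite nth_nil subn0. Qed.

Section Straight.

Variables (n : nat) (si : seq nat).
Hypothesis si_part : is_part si.
Implicit Type T : {ffun box si [::] -> 'I_n.+1}.

Let nil_part : is_part [::] := isT.

Lemma straight_pat_zero T k r : semistandard T -> k <= r -> k <= n.+1 -> pat T k r = 0.
Proof.
move=> ss; elim: k r => [|k IH] r; first by rewrite pat_start nth_nil.
case: r => // r le_k lt_k; apply/eqP; rewrite -leqn0 -(IH r) ?(ltnW lt_k) //.
by have [_ _ _ g_col] := pat_gt si_part nil_part (included_nil si) ss; exact: g_col.
Qed.

Lemma straight_size T : semistandard T -> size si <= n.+1.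
Proof.
move=> ss; rewrite leqNgt -part_nth_gt0 //.
by rewrite -(pat_end si_part (included_nil si) T _ (leqnn _)) straight_pat_zero.
Qed.

Lemma straight_row_le T b : semistandard T -> row_of b <= T b.
Proof.
move=> ss; rewrite leqNgt (pat_lt si_part nil_part (included_nil si)) //.
by rewrite straight_pat_zero // (leq_trans (ltnW (row_lt b))) // (straight_size ss).
Qed.

(** The first row of a lattice word read from the right can only contain the
    letter [0], hence by induction row [i] has no letter above [i]. *)
Lemma straight_le_row T b : lattice_rows T -> T b <= row_of b.
Proof.
move=> lat.
have none i l : i < size si -> i <= l -> #|[set b | (row_of b < i.+1) && (T b == l.+1 :> nat)]| = 0.
  elim: i l => [|i IH] l lt_i le_il; apply/eqP; rewrite -leqn0.
    case: (ltnP l n.+1) => lt_l.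
      have := forallP (forallP lat (Ordinal lt_i)) (Ordinal lt_l).
      rewrite /lattice_fails -leqNgt => /leq_trans; apply.
      by rewrite leqn0 cards_eq0; apply/eqP/setP=> c; rewrite !inE.
    rewrite leqn0 cards_eq0; apply/eqP/setP=> c.
    by rewrite !inE ltn_eqF ?andbF // (leq_trans (ltn_ord (T c))) // ltnW.
  case: (ltnP l n.+1) => lt_l; last first.
    rewrite leqn0 cards_eq0; apply/eqP/setP=> c.
    by rewrite !inE ltn_eqF ?andbF // (leq_trans (ltn_ord (T c))) // ltnW.
  have := forallP (forallP lat (Ordinal lt_i)) (Ordinal lt_l).
  rewrite /lattice_fails -leqNgt => /leq_trans; apply.
  by rewrite /=; case: l le_il {lt_l} => // l le_il; rewrite IH // ltnW.
rewrite leqNgt; apply/negP=> lt_b.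
have le_b : row_of b <= (T b).-1 by rewrite -ltnS (ltn_predK lt_b).
have /eqP := none _ _ (row_lt b) le_b; rewrite cards_eq0 => /eqP/setP/(_ b).
by rewrite !inE ltnSn (ltn_predK lt_b) eqxx.
Qed.

Lemma card_straight_row r : #|[set b : box si [::] | row_of b == r]| = nth 0 si r.
Proof.
have := @card_row si [::] r (nth 0 si r) si_part (included_nil si).
rewrite nth_nil subn0 leqnn => <- //; apply: eq_card => b; rewrite !inE.
by case: eqP => // <-; case/andP: (row_bounds b) => _ ->.
Qed.

Definition canonical_tab : {ffun box si [::] -> 'I_n.+1} := [ffun b => inord (row_of b)].

Hypothesis le_n : size si <= n.+1.

Lemma canonical_tabE b : canonical_tab b = row_of b :> nat.
Proof. by rewrite ffunE inordK // (leq_trans (row_lt b)). Qed.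

(** Column strictness gives [row_of b <= T b], and the lattice condition the
    converse. *)
Lemma canonical_tabP T : semistandard T && lattice_rows T = (T == canonical_tab).
Proof.
apply/andP/eqP => [[ss lat]|->].
  apply/ffunP=> b; apply: val_inj; rewrite /= canonical_tabE.
  by apply/eqP; rewrite eqn_leq straight_le_row // straight_row_le.
split; first by apply/semistandardP; split=> b c; rewrite !canonical_tabE // => ->.
apply/forallP=> i; apply/forallP=> l; rewrite /lattice_fails -leqNgt.
case: (ltnP l i) => [lt_l|le_l]; last first.
  rewrite (_ : [set b | _ && (_ == l.+1 :> nat)] = set0) ?cards0 //; apply/setP=> b.
  by rewrite !inE canonical_tabE; apply/negbTE/negP => /andP[lt_b /eqP eq_b]; lia.
apply: leq_trans (leq_trans (part_nth_leq si_part (leqnSn l)) _).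
  rewrite -card_straight_row subset_leq_card //; apply/subsetP=> b; rewrite !inE canonical_tabE.
  by case/andP.
rewrite -card_straight_row subset_leq_card //; apply/subsetP=> b.
rewrite !inE canonical_tabE => /eqP->.
by rewrite lt_l eqxx.
Qed.

Lemma canonical_weight k : weight canonical_tab k = nth 0 si k.
Proof.
rewrite -card_straight_row; apply: eq_card => b.
by rewrite !inE -val_eqE /= canonical_tabE.
Qed.

End Straight.

Lemma alt_sum_straight n si (a : 'I_n.+1 -> int) : is_part si ->
  (\sum_(T : {ffun box si [::] -> 'I_n.+1} | semistandard T)
     alt_sign (delta_shift (weight T)) a =
   (size si <= n.+1)%:R * alt_sign (delta_shift (nth 0%N si : 'I_n.+1 -> nat)) a)%R.
Proof.
move=> si_part; case: (leqP (size si) n.+1) => le_n; last first.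
  rewrite mul0r big1 // => T /(straight_size si_part).
  by rewrite leqNgt le_n.
rewrite mul1r alt_sum_lattice ?included_nil // (big_pred1 (canonical_tab n si)) => [|T].
  by apply: eq_alt_sign => k; rewrite /delta_shift canonical_weight.
by rewrite canonical_tabP.
Qed.

(** * Cutting a tableau at a letter *)

Lemma weight_eq_pat n n' th la th' la' (T : {ffun box th la -> 'I_n})
    (T' : {ffun box th' la' -> 'I_n'}) (k : 'I_n) (k' : 'I_n') :
    pat T k =1 pat T' k' -> pat T k.+1 =1 pat T' k'.+1 -> weight T k = weight T' k'.
Proof.
move=> eq_k eq_k1; pose R := maxn (size th) (size th').
have := sum_pat_weight T k (leq_maxl _ _ : size th <= R).
rewrite (eq_bigr _ (fun (r : 'I_R) _ => eq_k1 r)) (eq_bigr _ (fun (r : 'I_R) _ => eq_k r)).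
by rewrite (sum_pat_weight T' k' (leq_maxr _ _ : size th' <= R)) => /addnI.
Qed.

Section Split.

Variables (n0 n1 : nat) (th : seq nat).
Hypothesis th_part : is_part th.
Implicit Type T : {ffun box th [::] -> 'I_(n0.+1 + n1.+1)}.

Let nil_part : is_part [::] := isT.
Let nil_th : included [::] th := included_nil th.

Section FixedShape.

Variable la : seq nat.
Hypotheses (la_part : is_part la) (la_th : included la th).

Definition lower_tab T : {ffun box la [::] -> 'I_n0.+1} := tab n0 la [::] (pat T).
Definition upper_tab T : {ffun box th la -> 'I_n1.+1} :=
  tab n1 th la (fun k => pat T (n0.+1 + k)).

Definition glue_pat (T0 : {ffun box la [::] -> 'I_n0.+1})
    (T1 : {ffun box th la -> 'I_n1.+1}) k r :=
  if k <= n0.+1 then pat T0 k r else pat T1 (k - n0.+1) r.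

Definition glue_tab (T0 : {ffun box la [::] -> 'I_n0.+1})
    (T1 : {ffun box th la -> 'I_n1.+1}) : {ffun box th [::] -> 'I_(n0.+1 + n1.+1)} :=
  tab (n0 + n1.+1) th [::] (glue_pat T0 T1).

Section FromTableau.

Variable T : {ffun box th [::] -> 'I_(n0.+1 + n1.+1)}.
Hypotheses (ss : semistandard T) (T_la : forall r, pat T n0.+1 r = nth 0 la r).

Let gP : gt_pattern (n0.+1 + n1.+1) th [::] (pat T) :=
  pat_gt th_part nil_part nil_th ss.

Lemma lower_gt : gt_pattern n0.+1 la [::] (pat T).
Proof.
case: gP => g0 _ g_row g_col; split=> // k r lt_k.
  by apply: g_row; rewrite (leq_trans lt_k) // leq_addr.
by apply: g_col; rewrite (leq_trans lt_k) // leq_addr.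
Qed.

Lemma upper_gt : gt_pattern n1.+1 th la (fun k => pat T (n0.+1 + k)).
Proof.
case: gP => _ gn g_row g_col; split=> [r|//|k r lt_k|k r lt_k].
- by rewrite (addn0 n0.+1).
- by rewrite (addnS n0.+1 k); apply: g_row; rewrite ltn_add2l.
- by rewrite (addnS n0.+1 k); apply: g_col; rewrite ltn_add2l.
Qed.

Lemma lower_ss : semistandard (lower_tab T).
Proof. by apply: tab_semistandard lower_gt. Qed.

Lemma upper_ss : semistandard (upper_tab T).
Proof. exact: tab_semistandard upper_gt. Qed.

Lemma pat_lower k r : k <= n0.+1 -> pat (lower_tab T) k r = pat T k r.
Proof. by move=> le_k; apply: pat_tab le_k => //; exact: lower_gt. Qed.

Lemma pat_upper k r : k <= n1.+1 -> pat (upper_tab T) k r = pat T (n0.+1 + k) r.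
Proof. by move=> le_k; apply: pat_tab le_k => //; exact: upper_gt. Qed.

Lemma weight_lower k : weight (lower_tab T) k = weight T (lshift n1.+1 k).
Proof.
by apply: weight_eq_pat => r; rewrite pat_lower //= ltnW.
Qed.

Lemma weight_upper k : weight (upper_tab T) k = weight T (rshift n0.+1 k).
Proof.
by apply: weight_eq_pat => r; rewrite pat_upper ?(addnS n0.+1 k) // ltnW.
Qed.

End FromTableau.

Section FromPair.

Variables (T0 : {ffun box la [::] -> 'I_n0.+1}) (T1 : {ffun box th la -> 'I_n1.+1}).
Hypotheses (ss0 : semistandard T0) (ss1 : semistandard T1).

Lemma glue_patS k r : glue_pat T0 T1 (n0.+1 + k) r = pat T1 k r.
Proof.
rewrite /glue_pat; case: k => [|k]; last by rewrite -[X in _ <= X]addn0 leq_add2l addKn.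
by rewrite addn0 leqnn pat_start pat_end ?included_nil.
Qed.

Lemma glue_gt : gt_pattern (n0 + n1.+1).+1 th [::] (glue_pat T0 T1).
Proof.
have [g0 _ row0 col0] := pat_gt la_part nil_part (included_nil la) ss0.
have [_ gn row1 col1] := pat_gt th_part la_part la_th ss1.
split=> [r|r|k r|k r].
- by rewrite /glue_pat g0.
- by rewrite -addSn glue_patS gn.
- case: (ltnP k n0.+1) => [lt_k _|le_k lt_k]; first by rewrite /glue_pat lt_k (ltnW lt_k) row0.
  by rewrite -(subnKC le_k) -addnS !glue_patS row1 //; lia.
case: (ltnP k n0.+1) => [lt_k _|le_k lt_k]; first by rewrite /glue_pat lt_k (ltnW lt_k) col0.
by rewrite -(subnKC le_k) -addnS !glue_patS col1 //; lia.
Qed.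

Lemma glue_ss : semistandard (glue_tab T0 T1).
Proof. exact: tab_semistandard glue_gt. Qed.

Lemma pat_glue k r : k <= n0.+1 + n1.+1 -> pat (glue_tab T0 T1) k r = glue_pat T0 T1 k r.
Proof. by move=> le_k; apply: pat_tab le_k => //; exact: glue_gt. Qed.

Lemma pat_glue_lower k r : k <= n0.+1 -> pat (glue_tab T0 T1) k r = pat T0 k r.
Proof. by move=> le_k; rewrite pat_glue /glue_pat ?le_k // (leq_trans le_k) // leq_addr. Qed.

Lemma pat_glue_upper k r : k <= n1.+1 -> pat (glue_tab T0 T1) (n0.+1 + k) r = pat T1 k r.
Proof. by move=> le_k; rewrite pat_glue ?glue_patS // leq_add2l. Qed.

Lemma pat_glue_la r : pat (glue_tab T0 T1) n0.+1 r = nth 0 la r.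
Proof. by rewrite pat_glue_lower // pat_end ?included_nil. Qed.

Lemma lower_glue : lower_tab (glue_tab T0 T1) = T0.
Proof.
apply: (pat_inj la_part nil_part (included_nil la)) => // [|k r le_k].
  by apply: lower_ss; [exact: glue_ss | exact: pat_glue_la].
by rewrite pat_lower ?pat_glue_lower //; [exact: glue_ss | exact: pat_glue_la].
Qed.

Lemma upper_glue : upper_tab (glue_tab T0 T1) = T1.
Proof.
apply: (pat_inj th_part la_part la_th) => // [|k r le_k].
  by apply: upper_ss; [exact: glue_ss | exact: pat_glue_la].
by rewrite pat_upper ?pat_glue_upper //; [exact: glue_ss | exact: pat_glue_la].
Qed.

End FromPair.

Lemma glue_lower_upper T : semistandard T -> (forall r, pat T n0.+1 r = nth 0 la r) ->
  glue_tab (lower_tab T) (upper_tab T) = T.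
Proof.
move=> ss T_la; have ss0 := lower_ss ss T_la; have ss1 := upper_ss ss T_la.
apply: (pat_inj th_part nil_part nil_th) => // [|k r le_k]; first exact: glue_ss.
rewrite pat_glue // /glue_pat; case: leqP => le_kn; first by rewrite pat_lower.
rewrite pat_upper //; last by rewrite leq_subLR.
by rewrite subnKC // ltnW.
Qed.

(** For a fixed shape [la] of the first [n0.+1] letters, a pattern is cut at
    level [n0.+1] into a pattern of shape [la] and one of shape [th / la], and
    two such patterns can be glued along [la]. *)
Lemma card_split_shape (c : 'I_(n0.+1 + n1.+1) -> int) :
  #|[set T : {ffun box th [::] -> 'I_(n0.+1 + n1.+1)} |
      [&& semistandard T, [forall k, Posz (weight T k) == c k]
        & [forall r : 'I_(size th), pat T n0.+1 r == nth 0 la r]]]| =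
  kostka la (c \o @lshift _ _) * skew_kostka th la (c \o @rshift _ _).
Proof.
rewrite -cardsX.
have shapeE T : [forall r : 'I_(size th), pat T n0.+1 r == nth 0 la r] ->
    forall r, pat T n0.+1 r = nth 0 la r.
  move=> /forallP eq_r r; case: (ltnP r (size th)) => [lt_r|le_r].
    exact: eqP (eq_r (Ordinal lt_r)).
  rewrite nth_default ?(leq_trans (included_size la_part la_th)) //.
  by apply/eqP; rewrite -leqn0 -[0](nth_default 0 le_r) pat_le.
apply/eqP; rewrite eqn_leq; apply/andP; split.
  apply: (@card_le_inj _ _ _ _ (fun T => (lower_tab T, upper_tab T))
            (fun p => glue_tab p.1 p.2)) => T; rewrite !inE => /and3P[ss /forallP wt /shapeE T_la].
    rewrite /= lower_ss // upper_ss //=; apply/andP; split; apply/forallP=> k /=.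
      by have := wt (lshift _ k); rewrite -weight_lower.
    by rewrite weight_upper.
  exact: glue_lower_upper.
apply: (@card_le_inj _ _ _ _ (fun p => glue_tab p.1 p.2)
          (fun T => (lower_tab T, upper_tab T))) => -[T0 T1]; rewrite !inE /=.
  case/andP=> /andP[ss0 /forallP wt0] /andP[ss1 /forallP wt1].
  rewrite glue_ss //=; apply/andP; split; last by apply/forallP=> r; rewrite pat_glue_la.
  have ss := glue_ss ss0 ss1; have T_la := pat_glue_la ss0 ss1.
  apply/forallP=> k; rewrite -(splitK k); case: (split k) => j /=.
    by rewrite -weight_lower // lower_glue //; exact: wt0.
  by rewrite -weight_upper // upper_glue.
case/andP=> /andP[ss0 _] /andP[ss1 _]; by rewrite lower_glue // upper_glue.
Qed.

End FixedShape.

Lemma kostka_split (c : 'I_(n0.+1 + n1.+1) -> int) N0 :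
    (\sum_k c (lshift _ k))%R = Posz N0 ->
  kostka th c = \sum_(la <- partitions N0 | included la th)
    kostka la (c \o @lshift _ _) * skew_kostka th la (c \o @rshift _ _).
Proof.
move=> sum_c.
rewrite big_seq_cond (eq_bigr (fun la => \sum_(T : {ffun box th [::] -> 'I_(n0.+1 + n1.+1)} |
   semistandard T && [forall k, Posz (weight T k) == c k])
   ([forall r : 'I_(size th), pat T n0.+1 r == nth 0 la r] : nat))); last first.
  move=> la; rewrite mem_partitions => /andP[/andP[la_part _] la_th].
  rewrite -card_split_shape // -sum1_card big_mkcond [RHS]big_mkcond; apply: eq_bigr => T _.
  rewrite inE andbA; case: (semistandard T && [forall k, Posz (weight T k) == c k]) => //=.
rewrite -big_seq_cond exchange_big /= /kostka -sum1_card.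
rewrite [LHS](eq_bigl (fun T =>
  semistandard T && [forall k, Posz (weight T k) == c k])) => [|T]; last by rewrite inE.
apply: eq_bigr => T /andP[ss /forallP wt]; apply/esym.
have gP := pat_gt th_part nil_part nil_th ss.
have dec r : pat T n0.+1 r.+1 <= pat T n0.+1 r.
  by apply: (gt_dec nil_part gP) => //; rewrite leq_addr.
have [|la la_part T_la] := part_of_fun dec (R := size th).
  by apply/eqP; rewrite -leqn0 -[0](nth_default 0 (leqnn (size th))) pat_le.
have la_th : included la th by apply/includedP=> r; rewrite T_la pat_le.
have sum_la : sumn la = N0.
  rewrite -skew_size_nil -(sum_weight (lower_tab la T)) //; apply/eqP.
  rewrite -eqz_nat -sum_c (big_morph Posz PoszD (erefl _)); apply/eqP.
  by apply: eq_bigr => k _; rewrite weight_lower //; apply/eqP.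
rewrite big_mkcond (bigD1_seq la) ?partitions_uniq ?mem_partitions ?la_part ?sum_la //= la_th.
rewrite (_ : [forall r, _] = true); last by apply/forallP=> r; rewrite T_la.
rewrite big_seq_cond big1 // => la'; rewrite mem_partitions => /andP[/andP[la'_part _] neq].
case: ifP => // la'_th; apply/eqP; rewrite eqb0; apply: contra neq => /forallP eq_r.
apply/eqP/part_ext => // r; case: (ltnP r (size th)) => [lt_r|le_r].
  by rewrite T_la (eqP (eq_r (Ordinal lt_r))).
by rewrite !nth_default // (leq_trans (included_size _ _) le_r).
Qed.

End Split.

(** * The rows occupied by the two components *)

Lemma row_lt_len mu nu (b : box mu nu) : row_of b < skew_len mu nu.
Proof.
case: b => [[r k] bP]; case/andP: (bP) => le_k lt_k.
by apply: (bigop.leq_bigmax_cond r); exact: leq_ltn_trans lt_k.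
Qed.

Lemma full_row mu nu i : no_empty_rows mu nu -> i < skew_len mu nu -> nth 0 nu i < nth 0 mu i.
Proof. by move=> /forallP full lt_i; exact: full (Ordinal lt_i). Qed.

Lemma mem_component mu nu (b b0 : box mu nu) :
  (component b == component b0) = (b \in component b0).
Proof.
apply/eqP/idP => [<-|]; first by rewrite inE.
by rewrite inE => /same_component.
Qed.

(** A row of a skew shape is connected, so that a component is a union of
    whole rows, and a row of its translate ends where the corresponding row of
    the component does. The absence of empty rows in the translate makes the
    rows of the component consecutive. *)
Lemma component_rows mu nu mu0 nu0 (b0 : box mu nu) :
    skew_shape mu nu -> skew_shape mu0 nu0 -> no_empty_rows mu0 nu0 ->
    is_translate (component b0) mu0 nu0 ->
  exists r0 : nat, exists d : int,
    [/\ 0 < skew_len mu0 nu0,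
        forall b : box mu nu, (component b == component b0) =
          (r0 <= row_of b < r0 + skew_len mu0 nu0)
      & forall a, a < skew_len mu0 nu0 ->
          (Posz (nth 0%N mu (r0 + a)) = Posz (nth 0%N mu0 a) + d /\
           Posz (nth 0%N nu (r0 + a)) = Posz (nth 0%N nu0 a) + d)%R].
Proof.
case/and3P=> mu_part nu_part nu_mu /and3P[mu0_part nu0_part nu0_mu0] full0.
case=> f def_A [dr [dc f_move]].
have /imsetP[c0 _ def_b0] : b0 \in [set f b | b in [set: box mu0 nu0]] by rewrite def_A inE.
have len_gt0 : 0 < skew_len mu0 nu0 := leq_ltn_trans (leq0n _) (row_lt_len c0).
have row_min a : a < skew_len mu0 nu0 ->
    exists2 c : box mu0 nu0, row_of c = a & col_of c = nth 0 nu0 a.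
  by move=> lt_a; apply: box_at => //; rewrite leqnn full_row.
have row_max a : a < skew_len mu0 nu0 ->
    exists2 c : box mu0 nu0, row_of c = a & (col_of c).+1 = nth 0 mu0 a.
  move=> lt_a; have lt_row := full_row full0 lt_a.
  have [|c row_c col_c] := @box_at mu0 nu0 mu0_part a (nth 0 mu0 a).-1; first by lia.
  by exists c; rewrite // col_c (ltn_predK lt_row).
have [c1 row_c1 _] := row_min 0 len_gt0.
pose r0 := row_of (f c1).
have def_dr : dr = Posz r0 by have [+ _] := f_move c1; rewrite row_c1 add0r.
have row_f c : row_of (f c) = r0 + row_of c.
  by have [+ _] := f_move c; rewrite def_dr; lia.
have f_comp c : f c \in component b0 by rewrite -def_A imset_f ?inE.
have memE (b : box mu nu) : (b \in component b0) = (r0 <= row_of b < r0 + skew_len mu0 nu0).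
  apply/idP/idP => [|/andP[le_b lt_b]].
    by rewrite -def_A => /imsetP[c _ ->]; rewrite row_f leq_addr ltn_add2l row_lt_len.
  have lt_a : row_of b - r0 < skew_len mu0 nu0 by rewrite ltn_subLR.
  have [c row_c _] := row_min _ lt_a.
  rewrite -mem_component (_ : component b = component (f c)).
    by rewrite mem_component.
  by apply: same_row_component; rewrite row_f row_c subnKC.
exists r0, dc; split=> // [b|a lt_a]; first by rewrite mem_component.
have back (x : nat) : nth 0 nu (r0 + a) <= x < nth 0 mu (r0 + a) ->
    exists2 c : box mu0 nu0, row_of c = a & (Posz x = Posz (col_of c) + dc)%R.
  move=> rx; have [b row_b col_b] := box_at mu_part rx.
  have : b \in component b0 by rewrite memE row_b leq_addr ltn_add2l.
  rewrite -def_A => /imsetP[c _ def_b]; exists c; last first.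
    by have [_ +] := f_move c; rewrite -def_b col_b.
  by apply: (@addnI r0); rewrite -row_f -def_b.
have [cl row_cl col_cl] := row_min _ lt_a; have [cr row_cr col_cr] := row_max _ lt_a.
have bounds c : row_of c = a ->
    nth 0 nu (r0 + a) <= col_of (f c) < nth 0 mu (r0 + a).
  by move=> row_c; have := row_bounds (f c); rewrite row_f row_c.
have /andP[nl ml] := bounds _ row_cl; have /andP[nr mr] := bounds _ row_cr.
have [_ col_l] := f_move cl; have [_ col_r] := f_move cr.
have [|dl row_dl col_dl] := back (nth 0 nu (r0 + a)).
  by rewrite leqnn (leq_ltn_trans nl ml).
have [|dr' row_dr' col_dr'] := back (nth 0 mu (r0 + a)).-1; first by lia.
have := row_bounds dl; have := row_bounds dr'; rewrite row_dl row_dr'.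
by move: (nth 0 nu (r0 + a)) (nth 0 mu (r0 + a)) nl ml nr mr col_l col_r col_dl
  col_dr' col_cl col_cr => p q; clear; lia.
Qed.

Lemma consecutive_intervals n0 n1 r0 r1 : 0 < n0 -> 0 < n1 ->
    (forall i, i < n0 + n1 -> (r0 <= i < r0 + n0) (+) (r1 <= i < r1 + n1)) ->
  r0 = 0 /\ r1 = n0 \/ r0 = n1 /\ r1 = 0.
Proof.
move=> n0_gt0 n1_gt0 row01.
have h0 := row01 0; have hn0 := row01 n0; have hn1 := row01 n1.
have hr0 := row01 r0; have hr1 := row01 r1; clear row01.
lia.
Qed.

(** In the last clause [maxn r0 r1] is the first row of the lower component:
    if the rows before and after this border overlapped, they would contain a
    pair of adjacent boxes. It then extends to all pairs of rows by
    monotonicity. *)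
Lemma two_components_rows mu nu mu0 nu0 mu1 nu1 :
    skew_shape mu nu -> skew_shape mu0 nu0 -> skew_shape mu1 nu1 ->
    no_empty_rows mu nu -> no_empty_rows mu0 nu0 -> no_empty_rows mu1 nu1 ->
    two_components mu nu mu0 nu0 mu1 nu1 ->
  let n0 := skew_len mu0 nu0 in let n1 := skew_len mu1 nu1 in
  exists r0 r1 : nat, exists d0 d1 : int,
  [/\ 0 < n0 /\ 0 < n1, r0 = 0 /\ r1 = n0 \/ r0 = n1 /\ r1 = 0,
      forall a, a < n0 ->
        (Posz (nth 0%N mu (r0 + a)) = Posz (nth 0%N mu0 a) + d0 /\
         Posz (nth 0%N nu (r0 + a)) = Posz (nth 0%N nu0 a) + d0)%R,
      forall a, a < n1 ->
        (Posz (nth 0%N mu (r1 + a)) = Posz (nth 0%N mu1 a) + d1 /\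
         Posz (nth 0%N nu (r1 + a)) = Posz (nth 0%N nu1 a) + d1)%R
    & forall i j, i < maxn r0 r1 <= j -> nth 0 mu j <= nth 0 nu i].
Proof.
move=> skew skew0 skew1 full full0 full1 comps n0 n1.
have [len_eq _] := two_components_len_size skew skew0 skew1 full full0 full1 comps.
case: comps => b0 [b1 [neq01 all01 tr0 tr1]].
have [r0 [d0 [n0_gt0 rows0 eq0]]] := component_rows skew skew0 full0 tr0.
have [r1 [d1 [n1_gt0 rows1 eq1]]] := component_rows skew skew1 full1 tr1.
rewrite -/n0 -/n1 in n0_gt0 n1_gt0 rows0 rows1 eq0 eq1 len_eq.
have /and3P[mu_part nu_part nu_mu] := skew.
have row_box i : i < n0 + n1 -> exists2 b : box mu nu, row_of b = i & col_of b = nth 0 nu i.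
  by move=> lt_i; apply: box_at => //; rewrite leqnn full_row // len_eq.
have row01 i : i < n0 + n1 -> (r0 <= i < r0 + n0) (+) (r1 <= i < r1 + n1).
  move=> /row_box[b <- _]; rewrite -rows0 -rows1.
  by case: (all01 b) => ->; rewrite eqxx ?(negbTE neq01) // eq_sym (negbTE neq01).
have cases := consecutive_intervals n0_gt0 n1_gt0 row01.
exists r0, r1, d0, d1; split=> //.
pose m := maxn r0 r1.
have [m_gt0 m_lt] : 0 < m /\ m < n0 + n1.
  by rewrite /m; move: cases n0_gt0 n1_gt0; clear; lia.
have le_m : nth 0 mu m <= nth 0 nu m.-1.
  rewrite leqNgt; apply/negP=> lt_m.
  have [|b row_b col_b] := @box_at mu nu mu_part m.-1 (nth 0 nu m.-1).
    by rewrite leqnn full_row // len_eq (leq_ltn_trans (leq_pred m)).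
  have [|c row_c col_c] := @box_at mu nu mu_part m (nth 0 nu m.-1).
    by rewrite part_nth_leq ?leq_pred.
  have bc : component b = component c.
    apply: same_component; apply: connect1.
    by rewrite /adjacent row_b row_c col_b col_c (prednK m_gt0) !eqxx !orbT.
  have := rows0 b; rewrite bc rows0 row_b row_c /m.
  by move: cases n0_gt0 n1_gt0; clear; lia.
move=> i j /andP[lt_i le_j]; apply: leq_trans (part_nth_leq mu_part le_j) _.
by apply: leq_trans le_m (part_nth_leq nu_part _); rewrite -ltnS (prednK m_gt0).
Qed.

Local Open Scope ring_scope.

(** * The Littlewood-Richardson rule for Kostka numbers *)

(** The lattice condition at the end of the last row says that the weight is
    decreasing. *)
Lemma partition_of_weight n th la (T : {ffun box th la -> 'I_n}) :
    is_part th -> lattice_rows T ->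
  exists2 si, [/\ is_part si, sumn si = skew_size th la & (size si <= n)%N]
    & forall k : 'I_n, nth 0%N si k = weight T k.
Proof.
move=> th_part lat.
pose h k := #|[set b | T b == k :> nat]|.
have h_dec k : (h k.+1 <= h k)%N.
  case: (pickP (fun b => T b == k.+1 :> nat)) => [b /eqP T_b|no_b]; last first.
    rewrite {1}/h (_ : [set b | _] = set0) ?cards0 //; apply/setP=> b.
    by rewrite !inE no_b.
  have lt_k : (k < n)%N by rewrite ltnW // -T_b.
  have th_gt0 : (0 < size th)%N := leq_ltn_trans (leq0n _) (row_lt b).
  have lt_i : ((size th).-1 < size th)%N by rewrite ltn_predL.
  have := forallP (forallP lat (Ordinal lt_i)) (Ordinal lt_k).
  rewrite /lattice_fails -leqNgt /= (prednK th_gt0) => le_k.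
  apply: leq_trans (leq_trans le_k _); apply: subset_leq_card; apply/subsetP=> c.
    by rewrite !inE row_lt.
  by rewrite !inE => /andP[].
have hn : h n = 0%N.
  by apply/eqP; rewrite cards_eq0; apply/eqP/setP=> b; rewrite !inE ltn_eqF.
have [si si_part si_h] := part_of_fun h_dec hn.
exists si => [|k]; last by rewrite si_h.
have le_n : (size si <= n)%N by rewrite leqNgt -part_nth_gt0 // si_h hn.
split=> //; rewrite (sumn_nth le_n) -(sum_weight T) //.
by apply: eq_bigr => k _; exact: si_h.
Qed.

(** By cancellation both sides are sums over Littlewood-Richardson tableaux,
    grouped by weight on the right, where a tableau of weight [si] stands for
    the single one of straight shape [si]. *)
Lemma alt_sum_LR n th la (a : 'I_n.+1 -> int) :
    is_part th -> is_part la -> included la th ->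
  \sum_(T : {ffun box th la -> 'I_n.+1} | semistandard T)
     alt_sign (delta_shift (weight T)) a =
  \sum_(si <- partitions (skew_size th la)) (LR_coef th la si)%:R *
     \sum_(T : {ffun box si [::] -> 'I_n.+1} | semistandard T)
       alt_sign (delta_shift (weight T)) a.
Proof.
move=> th_part la_part la_th; rewrite alt_sum_lattice //.
pose E si := alt_sign (delta_shift (nth 0%N si : 'I_n.+1 -> nat)) a.
transitivity (\sum_(T : {ffun box th la -> 'I_n.+1} | semistandard T && lattice_rows T)
   \sum_(si <- partitions (skew_size th la) | (size si <= n.+1)%N)
     [forall k, weight T k == nth 0%N si k]%:R * E si).
  apply: eq_bigr => T /andP[ss lat].
  have [si0 [si0_part sum_si0 size_si0] si0_wt] := partition_of_weight th_part lat.
  have si0P : si0 \in partitions (skew_size th la).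
    by rewrite mem_partitions si0_part sum_si0 eqxx.
  rewrite big_mkcond (bigD1_seq si0) ?partitions_uniq //= size_si0.
  rewrite (_ : [forall k, _] = true) ?mul1r; last by apply/forallP=> k; rewrite si0_wt.
  rewrite big_seq_cond big1 ?addr0 => [|si].
    by apply: eq_alt_sign => k; rewrite /delta_shift si0_wt.
  rewrite mem_partitions => /andP[/andP[si_part _] neq_si]; case: ifP => // size_si.
  rewrite (_ : [forall k, _] = false) ?mul0r //; apply: contraNF neq_si => /forallP wt.
  apply/eqP/part_ext => // i; case: (ltnP i n.+1) => [lt_i|le_i].
    by rewrite (si0_wt (Ordinal lt_i)) (eqP (wt (Ordinal lt_i))).
  by rewrite !nth_default // (leq_trans _ le_i).
rewrite exchange_big big_mkcond big_seq [RHS]big_seq.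
apply: eq_bigr => si; rewrite mem_partitions => /andP[si_part _].
rewrite alt_sum_straight // -/(E si); case: ifP => [size_si|_]; last by rewrite mul0r mulr0.
rewrite mul1r -mulr_suml -natr_sum (LR_coef_letters la_th size_si); congr (_%:R * _).
rewrite -sum1_card big_mkcond [RHS]big_mkcond; apply: eq_bigr => T _.
rewrite inE; case: (boolP (semistandard T)) => //= ss; rewrite lattice_wordE //.
by case: (lattice_rows T); case: ([forall k, _]).
Qed.

Definition staircase n (i : 'I_n) : int := Posz (n.-1 - i).

(** The sums over [w] and over the tableaux are exchanged. As Kostka numbers
    are symmetric, the left side is the coefficient of [x ^ a] in the product
    of the alternant of [delta] with the generating function of the tableaux. *)
Lemma skew_kostka_alt_sum n th la (a : 'I_n.+1 -> int) :
  \sum_(w : 'S_n.+1) (-1) ^+ w *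
    (skew_kostka th la (fun i => a (w i) - staircase i))%:R =
  \sum_(T : {ffun box th la -> 'I_n.+1} | semistandard T)
     alt_sign (delta_shift (weight T)) a.
Proof.
rewrite exchange_big; apply: eq_bigr => w _; rewrite -mulr_sumr -natr_sum; congr (_ * _%:R).
rewrite /skew_kostka -sum1_card big_mkcond [RHS]big_mkcond; apply: eq_bigr => T _.
rewrite inE; case: (semistandard T) => //=.
rewrite (_ : [forall k, _] = [forall i, a (w i) == delta_shift (weight T) i]).
  by case: [forall i, _].
apply: eq_forallb => k; rewrite /delta_shift /staircase PoszD eq_sym subr_eq.
by [].
Qed.

(** The scalar product with [delta]. *)
Definition height n (c : 'I_n -> int) : int := \sum_i staircase i * c i.

(** Twice the difference is the squared distance from [delta] to its
    rearrangement. *)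
Lemma height_perm n (w : 'S_n) : w != 1%g ->
  height (fun i => staircase (w i)) < height (@staircase n).
Proof.
move=> w_neq1; rewrite -subr_gt0.
have [i neq_i] : exists i, w i != i.
  apply/existsP; apply: contraNT w_neq1; rewrite negb_exists => /forallP fix_w.
  by apply/eqP/permP=> i; rewrite perm1; apply/eqP; have := fix_w i; rewrite negbK.
have stair_inj (j k : 'I_n) : staircase j = staircase k -> j = k.
  rewrite /staircase => -[eq_jk]; apply: val_inj => /=.
  by have := ltn_ord j; have := ltn_ord k; lia.
have sq : \sum_j (staircase j - staircase (w j)) ^+ 2 =
    (height (@staircase n) - height (fun i => staircase (w i))) *+ 2.
  apply/eqP; rewrite -subr_eq0 /height -sumrB -sumrMnl -sumrB.
  rewrite (eq_bigr (fun j => staircase (w j) ^+ 2 - staircase j ^+ 2)) => [|j _]; last by ring.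
  by rewrite sumrB [X in _ - X](reindex_inj (@perm_inj _ w)) subrr.
suff: 0 < \sum_j (staircase j - staircase (w j)) ^+ 2 by rewrite sq mulr2n; lia.
rewrite (bigD1 i) //= ltr_wpDr //; first by apply: sumr_ge0 => j _; exact: sqr_ge0.
rewrite exprn_even_gt0 //= subr_eq0; apply: contraNneq neq_i => /stair_inj <-.
by rewrite eqxx.
Qed.

(** Multiplication by the alternant of [delta] is injective on symmetric
    functions with bounded support: in the coefficient at [c + delta], the
    terms for [w != 1] evaluate [F] at points higher than [c], where it
    vanishes by induction. *)
Lemma alternant_inversion n (F : ('I_n -> int) -> int) (B : int) :
    (forall c d, c =1 d -> F c = F d) ->
    (forall c (w : 'S_n), F (c \o w) = F c) ->
    (forall c, F c != 0 -> height c <= B) ->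
    (forall a, \sum_(w : 'S_n) (-1) ^+ w * F (fun i => a (w i) - staircase i) = 0) ->
  forall c, F c = 0.
Proof.
move=> F_ext F_sym F_bound F_alt.
(* Downward induction on the height, which is bounded on the support. *)
suff IH m c : B < height c + Posz m -> F c = 0.
  move=> c; apply: (IH `|B - height c|.+1%N); lia.
elim: m c => [|m IH] c lt_B.
  by apply/eqP; apply: contraTT lt_B => /F_bound; rewrite addr0 -leNgt.
have := F_alt (fun i => c i + staircase i); rewrite (bigD1 1%g) //= odd_perm1 mul1r.
rewrite (F_ext _ c) => [|i]; last by rewrite perm1 addrK.
rewrite big1 ?addr0 // => w w_neq1.
rewrite -[F _](F_sym _ w^-1%g) IH ?mulr0 //.
have winv_neq1 : w^-1%g != 1%g by rewrite invg_eq1.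
have := height_perm winv_neq1.
rewrite [X in B < X + _](_ : _ = height c + (height (@staircase n)
                                 - height (fun i => staircase (w^-1%g i)))).
  by move: lt_B; move: (height c) (height _) (height _); clear; lia.
rewrite /height -sumrB -big_split /=; apply: eq_bigr => i _.
by rewrite permKV; ring.
Qed.

Lemma height_bound n th la (c : 'I_n -> int) : is_part th ->
  skew_kostka th la c != 0%N -> height c <= Posz (n * skew_size th la).
Proof.
move=> th_part; rewrite -lt0n => /card_gt0P[T]; rewrite inE => /andP[_ /forallP wt].
rewrite -(sum_weight T) // big_distrr /= (big_morph Posz PoszD (erefl _)).
apply: ler_sum => i _; rewrite -(eqP (wt i)) /staircase -PoszM lez_nat leq_mul //.
by have := ltn_ord i; lia.
Qed.

(** After multiplication by the alternant of [delta] both sides agree by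
    [alt_sum_LR], and the alternant can be cancelled. *)
Theorem Littlewood_Richardson n th la (c : 'I_n.+1 -> int) :
    is_part th -> is_part la -> included la th ->
  skew_kostka th la c =
  (\sum_(si <- partitions (skew_size th la)) LR_coef th la si * kostka si c)%N.
Proof.
move=> th_part la_part la_th.
pose N := skew_size th la.
pose F (d : 'I_n.+1 -> int) : int := (skew_kostka th la d)%:R -
  \sum_(si <- partitions N) (LR_coef th la si)%:R * (skew_kostka si [::] d)%:R.
suff: F c = 0.
  move/eqP; rewrite subr_eq0 => /eqP eq_c; apply/eqP; rewrite -(eqr_nat int); apply/eqP.
  rewrite eq_c natr_sum; apply: eq_bigr => si _; by rewrite natrM.
have size_si si : si \in partitions N -> skew_size si [::] = N /\ is_part si.
  by rewrite mem_partitions skew_size_nil => /andP[-> /eqP].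
apply: (@alternant_inversion _ F (Posz (n.+1 * N))) => [d e eq_de|d w|d|a].
- rewrite /F (eq_skew_kostka _ _ eq_de); congr (_ - _); apply: eq_bigr => si _.
  by rewrite (eq_skew_kostka _ _ eq_de).
- rewrite /F skew_kostka_perm //; congr (_ - _); rewrite big_seq [RHS]big_seq.
  apply: eq_bigr => si /size_si[_ si_part]; rewrite skew_kostka_perm //.
- move=> Fd; case: (eqVneq (skew_kostka th la d) 0%N) => [d0|]; last exact: height_bound.
  move: Fd; rewrite /F d0 sub0r oppr_eq0 => Fd.
  have [si siP d_si] : exists2 si, si \in partitions N & skew_kostka si [::] d != 0%N.
    apply/hasP; apply: contraNT Fd => /hasPn all0; rewrite big_seq big1 // => si /all0.
    by rewrite negbK => /eqP->; rewrite mulr0.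
  have [<- si_part] := size_si _ siP; exact: height_bound.
rewrite /F; under eq_bigr => w _ do rewrite mulrBr mulr_sumr.
rewrite sumrB skew_kostka_alt_sum alt_sum_LR // exchange_big /=.
apply/eqP; rewrite subr_eq0; apply/eqP.
apply: eq_bigr => si _; rewrite -skew_kostka_alt_sum mulr_sumr; apply: eq_bigr => w _.
by rewrite mulrCA.
Qed.

(** * Immanant characters and induction products as sums over the group *)

(** Coproduct of a Schur function, on coefficients. *)
Theorem kostka_concat n0 n1 th N0 N1 (c : 'I_(n0.+1 + n1.+1) -> int) :
    is_part th -> sumn th = (N0 + N1)%N -> \sum_k c (lshift _ k) = Posz N0 ->
  kostka th c = (\sum_(la <- partitions N0 | included la th)
    \sum_(si <- partitions N1) LR_coef th la si *
      (kostka la (c \o @lshift _ _) * kostka si (c \o @rshift _ _)))%N.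
Proof.
move=> th_part sum_th sum_c; rewrite (kostka_split th_part sum_c) big_seq_cond [RHS]big_seq_cond.
apply: eq_bigr => la; rewrite mem_partitions => /andP[/andP[la_part /eqP sum_la] la_th].
have size_N1 : skew_size th la = N1.
  apply: (@addnI N0); rewrite -sum_th -sum_la (sumn_nth (included_size la_part la_th)).
  rewrite (sumn_nth (leqnn _)) -big_split; apply: eq_bigr => i _ /=.
  by rewrite subnKC // (includedP _ _ la_th).
rewrite Littlewood_Richardson // size_N1 big_distrr; apply: eq_bigr => si _ /=.
by rewrite mulnCA.
Qed.

(** Every element of the class is [w ^ g] for the same number of [g], the
    order of the centraliser. *)
Lemma class_average (gT : finGroupType) (w : gT) (f : gT -> algC) :
  #|gT|%:R / #|(w ^: [set: gT])%g|%:R * \sum_(x in (w ^: [set: gT])%g) f x =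
  \sum_g f (w ^ g)%g.
Proof.
have card_eq : (#|'C[w]%g| * #|(w ^: [set: gT])%g|)%N = #|gT|.
  by rewrite -index_cent1 setTI Lagrange ?subsetT // cardsT.
have class_neq0 : #|(w ^: [set: gT])%g|%:R != 0 :> algC.
  by rewrite pnatr_eq0 -lt0n; apply/card_gt0P; exists w; exact: class_refl.
rewrite -card_eq natrM mulfK // mulr_sumr.
rewrite [RHS](partition_big (fun g => (w ^ g)%g) (mem (w ^: [set: gT])%g)) /=; last first.
  by move=> g _; rewrite memJ_class ?inE.
apply: eq_bigr => _ /imsetP[h _ ->].
rewrite (eq_bigr (fun=> f (w ^ h)%g)) => [|g /eqP -> //]; rewrite sumr_const -[RHS]mulr_natl.
congr (_%:R * _); rewrite -(card_rcoset _ h); apply: eq_card => g.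
rewrite mem_rcoset; apply/cent1P/eqP => [wC|eq_g].
  by rewrite -{1}(mulgKV h g) conjgM [(w ^ (g * _))%g]conjgE -wC mulKg.
by rewrite /commute [RHS]conjgC conjgM eq_g conjgK.
Qed.

Lemma immanantE n th mu nu (w : 'S_n) :
  immanant n th mu nu w = \sum_g (kostka th (immanant_content mu nu (w ^ g)%g))%:R.
Proof.
rewrite cfunE /immanant_val -(class_average w (fun x => (kostka th (immanant_content mu nu x))%:R)).
by rewrite card_Sn.
Qed.

Section InducedAverage.

Variables (k l : nat) (f0 : 'S_k -> algC) (f1 : 'S_l -> algC).
Variables (phi : 'CF([set: 'S_k])) (psi : 'CF([set: 'S_l])).
Hypothesis phiE : forall s, phi s = \sum_a f0 (s ^ a)%g.
Hypothesis psiE : forall t, psi t = \sum_b f1 (t ^ b)%g.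

Let F (p : 'S_k * 'S_l) := f0 p.1 * f1 p.2.

Lemma ext_prodE p : ext_prod phi psi p = \sum_q F (p ^ q)%g.
Proof.
rewrite cfunE phiE psiE big_distrlr /= pair_big /=.
by apply: eq_bigr.
Qed.

Lemma block_permMM (p q : 'S_k * 'S_l) : block_perm (p * q)%g = (block_perm p * block_perm q)%g.
Proof. by rewrite block_permM ?inE. Qed.

Lemma block_permJ (p q : 'S_k * 'S_l) : block_perm (p ^ q)%g = (block_perm p ^ block_perm q)%g.
Proof.
by apply: (mulgI (block_perm q)); rewrite -block_permMM -!conjgC block_permMM.
Qed.

Lemma block_perm_injective : injective (@block_perm k l).
Proof. by move=> p q eq_pq; apply: (injmP (block_perm_injm k l)); rewrite ?inE. Qed.

(** The sum over the Young subgroup hidden in [phi] and [psi] is absorbed by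
    translating [g], and the resulting factor cancels with the one in the
    definition of induced characters. *)
Lemma ind_prodE w : ind_prod phi psi w =
  \sum_g \sum_p (block_perm p == w ^ g)%g%:R * F p.
Proof.
rewrite /ind_prod cfIndE ?subsetT //.
have isomE x : cfIsom (block_perm_isom k l) (ext_prod phi psi) x =
    \sum_p (block_perm p == x)%:R * ext_prod phi psi p.
  case: (boolP (x \in young_subgroup k l)) => [/morphimP[p p1 p2 ->]|notx].
    rewrite cfIsomE // (bigD1 p) //= eqxx mul1r big1 ?addr0 // => q neq_qp.
    by rewrite (inj_eq block_perm_injective) (negbTE neq_qp) mul0r.
  rewrite cfun0 // big1 // => p _; case: eqP => [def_x|]; last by rewrite mul0r.
  by case/negP: notx; rewrite -def_x; apply: (mem_morphim (block_perm_morphism k l)); rewrite inE.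
rewrite (eq_bigr _ (fun g _ => isomE (w ^ g)%g)).
rewrite (eq_bigl predT) => [|g]; last by rewrite inE.
under eq_bigr => g _ do under eq_bigr => p _ do rewrite ext_prodE mulr_sumr.
under eq_bigr => g _ do rewrite exchange_big.
rewrite exchange_big /=.
rewrite (eq_bigr (fun=> \sum_g \sum_p (block_perm p == w ^ g)%g%:R * F p)) => [|q _].
  rewrite sumr_const -[X in _ * X]mulr_natl mulrA (_ : #|young_subgroup k l| = #|{: 'S_k * 'S_l}|).
    by rewrite mulVf ?mul1r // pnatr_eq0 -lt0n; apply/card_gt0P; exists 1%g.
  by rewrite card_injm ?block_perm_injm // cardsT.
rewrite (reindex_inj (mulIg (block_perm q)^-1%g)); apply: eq_bigr => g _.
rewrite [RHS](reindex_inj (@conjg_inj _ q)); apply: eq_bigr => p _; congr (_%:R * _).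
congr nat_of_bool; rewrite block_permJ conjgM.
by apply/eqP/eqP => [->|<-]; rewrite ?conjgKV ?conjgK.
Qed.

End InducedAverage.

(** * The induction product formula *)

Lemma block_permL k l (p : 'S_k * 'S_l) a : block_perm p (lshift l a) = lshift l (p.1 a).
Proof. by rewrite permE /block_fun (unsplitK (inl _)). Qed.

Lemma block_permR k l (p : 'S_k * 'S_l) b : block_perm p (rshift k b) = rshift k (p.2 b).
Proof. by rewrite permE /block_fun (unsplitK (inr _)). Qed.

Lemma block_permV k l (p : 'S_k * 'S_l) : (block_perm p)^-1%g = block_perm p^-1%g.
Proof.
apply: (mulgI (block_perm p)); rewrite mulgV -block_permMM mulgV.
exact/esym/(morph1 (block_perm_morphism k l)).
Qed.

(** An injection of a finite set into itself is onto. *)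
Lemma perm_stable (T : finType) (y : {perm T}) (A : {set T}) :
  (forall i, i \in A -> y i \in A) -> forall i, (y i \in A) = (i \in A).
Proof.
move=> yA i; have /setP/(_ (y i)) : [set y j | j in A] = A.
  apply/eqP; rewrite eqEcard card_imset ?leqnn ?andbT; last exact: perm_inj.
  by apply/subsetP=> _ /imsetP[j Aj ->]; exact: yA.
by rewrite mem_imset //; exact: perm_inj.
Qed.

Lemma block_perm_of_stable k l (y : 'S_(k + l)) :
  (forall i, (y i < k)%N = (i < k)%N) -> exists p, y = block_perm p.
Proof.
move=> y_st.
have sL (a : 'I_k) : {a' | y (lshift l a) = lshift l a'}.
  have lt_a : (y (lshift l a) < k)%N by rewrite y_st /=.
  by exists (Ordinal lt_a); apply: val_inj.
have sR (b : 'I_l) : {b' | y (rshift k b) = rshift k b'}.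
  have le_b : (k <= y (rshift k b))%N by rewrite leqNgt y_st -leqNgt leq_addr.
  have lt_b : (y (rshift k b) - k < l)%N by rewrite ltn_subLR.
  by exists (Ordinal lt_b); apply: val_inj; rewrite /= subnKC.
have s_inj : injective (fun a => sval (sL a)).
  move=> a a' /(congr1 (lshift l)); rewrite -!(svalP (sL _)).
  by move/perm_inj/lshift_inj.
have t_inj : injective (fun b => sval (sR b)).
  move=> a a' /(congr1 (@rshift k l)); rewrite -!(svalP (sR _)).
  by move/perm_inj/rshift_inj.
exists (perm s_inj, perm t_inj); apply/permP=> i; rewrite -(splitK i).
case: (split i) => a /=; rewrite ?block_permL ?block_permR /= permE.
  exact: svalP (sL a).
exact: svalP (sR a).
Qed.

Lemma immanant_contentJ n mu nu (x e : 'S_n) j :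
  immanant_content mu nu (x ^ e)%g (e j) =
  Posz (nth 0%N mu (e j) + (n.-1 - e j)) -
  Posz (nth 0%N nu (e ((x^-1)%g j)) + (n.-1 - e ((x^-1)%g j))).
Proof. by rewrite /immanant_content -conjVg permJ. Qed.

(** The permutation rearranges the entries of [nu + delta], which does not
    change their sum. *)
Lemma sum_content mu nu (w : 'S_(skew_len mu nu)) : skew_shape mu nu ->
  \sum_i immanant_content mu nu w i = Posz (skew_size mu nu).
Proof.
case/and3P=> _ _ /includedP nu_mu.
rewrite /immanant_content sumrB [X in _ - X](reindex_inj (@perm_inj _ w)) /=.
rewrite -sumrB (eq_bigr (fun i : 'I__ => Posz (nth 0%N mu i - nth 0%N nu i))) => [|i _]; last first.
  by rewrite permK; have := nu_mu i; lia.
rewrite -(big_morph Posz PoszD (erefl _)); congr Posz; rewrite /skew_size.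
have le_len : (skew_len mu nu <= size mu)%N by apply/bigop.bigmax_leqP => i _.
rewrite (big_ord_widen _ (fun i => nth 0%N mu i - nth 0%N nu i)%N le_len) big_mkcond.
apply: eq_bigr => i _; case: ifP => // /negbT; rewrite -leqNgt => le_i.
apply/eqP; rewrite eq_sym subn_eq0 leqNgt; apply: contraL le_i => lt_i.
by rewrite -ltnNge; apply: (bigop.leq_bigmax_cond i).
Qed.

(** Needed when the first component is the lower one: its [k] rows come after
    the [l] rows of the other one. *)
Lemma block_swap k l : exists e : 'S_(k + l),
  (forall a, e (lshift l a) = l + a :> nat)%N /\ (forall b, e (rshift k b) = b :> nat).
Proof.
pose h (i : 'I_(k + l)) : 'I_(k + l) := cast_ord (addnC l k)
  (match split i with inl a => rshift l a | inr b => lshift k b end).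
have hL a : h (lshift l a) = l + a :> nat by rewrite /h (unsplitK (inl _)).
have hR b : h (rshift k b) = b :> nat by rewrite /h (unsplitK (inr _)).
have h_inj : injective h.
  move=> i j; rewrite -(splitK i) -(splitK j); case: (split i) => a; case: (split j) => b /=;
    move/(congr1 (@nat_of_ord _)); rewrite ?hL ?hR.
  - by move/addnI/val_inj->.
  - by move=> eq_ab; have := ltn_ord b; rewrite -eq_ab ltnNge leq_addr.
  - by move=> eq_ab; have := ltn_ord a; rewrite eq_ab ltnNge leq_addr.
  - by move/val_inj->.
by exists (perm h_inj); split=> i; rewrite permE.
Qed.

(** The permutation [e] sends the rows of the two components, listed one after
    the other, to their positions in [mu / nu]. Conjugation by [e] is harmless
    in the sum over the group, and composition of a content with [e] is
    harmless by the symmetry of Kostka numbers. *)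
Lemma immanant_product n0 n1 (mu nu mu0 nu0 mu1 nu1 th : seq nat) N0 N1
    (e : 'S_(n0.+1 + n1.+1)) :
    is_part th -> sumn th = (N0 + N1)%N ->
    (forall p a, immanant_content mu nu (block_perm p ^ e)%g (e (lshift _ a)) =
       immanant_content mu0 nu0 p.1 a) ->
    (forall p b, immanant_content mu nu (block_perm p ^ e)%g (e (rshift _ b)) =
       immanant_content mu1 nu1 p.2 b) ->
    (forall x, (forall i, 0 <= immanant_content mu nu (x ^ e)%g i) ->
       exists p, x = block_perm p) ->
    (forall s : 'S_n0.+1, \sum_a immanant_content mu0 nu0 s a = Posz N0) ->
  immanant (n0.+1 + n1.+1) th mu nu =
  \sum_(la <- partitions N0 | included la th)
    \sum_(si <- partitions N1) (LR_coef th la si)%:R *: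
      ind_prod (immanant n0.+1 la mu0 nu0) (immanant n1.+1 si mu1 nu1).
Proof.
move=> th_part sum_th contentL contentR support sum0; apply/cfunP=> w.
pose K0 la (p : 'S_n0.+1 * 'S_n1.+1) := kostka la (immanant_content mu0 nu0 p.1).
pose K1 si (p : 'S_n0.+1 * 'S_n1.+1) := kostka si (immanant_content mu1 nu1 p.2).
pose E (g : 'S_(n0.+1 + n1.+1)) (p : 'S_n0.+1 * 'S_n1.+1) : algC :=
  (block_perm p == w ^ g)%g%:R.
have symK (c : 'I_(n0.+1 + n1.+1) -> int) : kostka th c = kostka th (c \o e) :=
  esym (skew_kostka_perm th_part (isT : is_part [::]) (included_nil th) c e).
transitivity (\sum_g \sum_p E g p * \sum_(la <- partitions N0 | included la th)
  \sum_(si <- partitions N1) (LR_coef th la si)%:R * ((K0 la p)%:R * (K1 si p)%:R)).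
  rewrite immanantE (reindex_inj (mulIg e)); apply: eq_bigr => g _ /=.
  rewrite conjgM; set x := (w ^ g)%g.
  have [[p def_x]|no_p] : (exists p, x = block_perm p) \/ ~ (exists p, x = block_perm p).
    case: (boolP [exists p, x == block_perm p]) => [/existsP[p /eqP]|no_p]; first by left; exists p.
    by right=> -[p def_x]; case/existsP: no_p; exists p; apply/eqP.
  - rewrite (bigD1 p) //= [X in _ = _ + X]big1 ?addr0 => [|q neq_qp]; last first.
      by rewrite /E -/x def_x (inj_eq (@block_perm_injective _ _)) (negbTE neq_qp) mul0r.
    rewrite /E -/x def_x eqxx mul1r symK (kostka_concat th_part sum_th) => [|]; last first.
      by rewrite -[RHS](sum0 p.1); apply: eq_bigr => a _; exact: contentL.
    rewrite natr_sum; apply: eq_bigr => la _; rewrite natr_sum; apply: eq_bigr => si _.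
    rewrite natrM natrM; congr (_ * (_%:R * _%:R)).
      by apply: eq_skew_kostka => a; exact: contentL.
    by apply: eq_skew_kostka => b; exact: contentR.
  rewrite [RHS]big1 => [|p _]; last first.
    by rewrite /E -/x; case: eqP => [def_x|]; rewrite ?mul0r //; case: no_p; exists p.
  apply/eqP; rewrite pnatr_eq0 cards_eq0; apply/eqP/setP=> T; rewrite !inE.
  apply/negbTE/negP=> /andP[_ /forallP wt]; case: no_p; apply: support => i.
  by rewrite -(eqP (wt i)).
rewrite sum_cfunE.
under eq_bigr => g _ do under eq_bigr => p _ do rewrite mulr_sumr.
under eq_bigr => g _ do rewrite exchange_big.
rewrite exchange_big; apply: eq_bigr => la _; rewrite sum_cfunE.
under eq_bigr => g _ do under eq_bigr => p _ do rewrite mulr_sumr.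
under eq_bigr => g _ do rewrite exchange_big.
rewrite exchange_big; apply: eq_bigr => si _; rewrite cfunE.
rewrite (@ind_prodE _ _ (fun s => (kostka la (immanant_content mu0 nu0 s))%:R)
  (fun t => (kostka si (immanant_content mu1 nu1 t))%:R)) ?mulr_sumr.
- apply: eq_bigr => g _; rewrite mulr_sumr; apply: eq_bigr => p _.
  by rewrite mulrCA.
- by move=> s; exact: immanantE.
- by move=> t; exact: immanantE.
Qed.

Theorem proposition3p5 (mu nu mu0 nu0 mu1 nu1 theta : seq nat)
    (skew : skew_shape mu nu) (skew0 : skew_shape mu0 nu0) (skew1 : skew_shape mu1 nu1)
    (full : no_empty_rows mu nu)
    (full0 : no_empty_rows mu0 nu0) (full1 : no_empty_rows mu1 nu1)
    (comps : two_components mu nu mu0 nu0 mu1 nu1)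
    (part_theta : is_part theta)
    (size_theta : sumn theta = (skew_size mu0 nu0 + skew_size mu1 nu1)%N) :
  immanant (skew_len mu0 nu0 + skew_len mu1 nu1) theta mu nu =
  \sum_(la <- partitions (skew_size mu0 nu0) | included la theta)
    \sum_(si <- partitions (skew_size mu1 nu1))
      (LR_coef theta la si)%:R *:
        ind_prod (immanant (skew_len mu0 nu0) la mu0 nu0)
                 (immanant (skew_len mu1 nu1) si mu1 nu1).
Proof.
have [r0 [r1 [d0 [d1 [[]]]]]] := two_components_rows skew skew0 skew1 full full0 full1 comps.
have := @sum_content mu0 nu0 ^~ skew0.
move: (skew_len mu0 nu0) (skew_len mu1 nu1) => [//|n0] [//|n1] sum0 _ _ cases rows0 rows1 separated.
have [e [eL eR]] : exists e : 'S_(n0.+1 + n1.+1),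
    (forall a, e (lshift _ a) = r0 + a :> nat)%N /\
    (forall b, e (rshift _ b) = r1 + b :> nat)%N.
  case: cases => [[-> ->]|[-> ->]]; last exact: block_swap.
  by exists 1%g; split=> i; rewrite perm1.
have le_r : (r0 + n0.+1 <= n0.+1 + n1.+1)%N /\ (r1 + n1.+1 <= n0.+1 + n1.+1)%N.
  by move: cases; clear; lia.
apply: (immanant_product (e := e) part_theta size_theta) => [p a|p b|x nonneg|//].
- rewrite immanant_contentJ block_permV block_permL -[(p^-1)%g.1 a]/((p.1^-1)%g a).
  rewrite !eL /immanant_content.
  have [mu_a _] := rows0 a (ltn_ord a).
  have [_ nu_a] := rows0 _ (ltn_ord ((p.1^-1)%g a)).
  have lt_a := ltn_ord a; have := ltn_ord ((p.1^-1)%g a).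
  rewrite !PoszD mu_a nu_a /=; move: le_r lt_a.
  by move: ((p.1^-1)%g a) => a'; clear; lia.
- rewrite immanant_contentJ block_permV block_permR -[(p^-1)%g.2 b]/((p.2^-1)%g b).
  rewrite !eR /immanant_content.
  have [mu_a _] := rows1 b (ltn_ord b).
  have [_ nu_a] := rows1 _ (ltn_ord ((p.2^-1)%g b)).
  have lt_a := ltn_ord b; have := ltn_ord ((p.2^-1)%g b).
  rewrite !PoszD mu_a nu_a /=; move: le_r lt_a.
  by move: ((p.2^-1)%g b) => b'; clear; lia.
pose m := maxn r0 r1.
pose low := [set j | (m <= e j)%N].
(* Nonnegative contents forbid an upper row to take the place of a lower one. *)
have low_stable j : ((x^-1)%g j \in low) = (j \in low).
  apply: perm_stable => i; rewrite !inE => le_i; rewrite leqNgt; apply/negP=> lt_i.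
  have := nonneg (e i); rewrite immanant_contentJ.
  have := separated _ (e i) (introT andP (conj lt_i le_i)).
  have lt_n := ltn_ord (e i); move: lt_i le_i lt_n.
  by move: (nth 0%N mu _) (nth 0%N nu _) => p q; clear; lia.
have [p def_x] : exists p, (x^-1)%g = block_perm p.
  (* The lower component is the second one exactly when the first starts at row 0. *)
have lowE j : (j \in low) = if r0 == 0%N then (n0.+1 <= j)%N else (j < n0.+1)%N.
    rewrite inE /m -(splitK j); case: (split j) => i /=; rewrite ?eL ?eR.
      by move: cases (ltn_ord i); clear; case: eqP; lia.
    by move: cases (ltn_ord i); clear; case: eqP; lia.
  apply: block_perm_of_stable => j; have := low_stable j; rewrite !lowE.
  by case: ifP => // _; rewrite !ltnNge => ->.
by exists p^-1%g; rewrite -block_permV -def_x invgK.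
Qed.
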